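(* Let $H$ be a real Hilbert space with $\dim H\ge2$, let $\mathbb B_H=\{x\in H:|x|<1\}$, and let $F:\mathbb D\to\mathbb B_H$ be harmonic. Suppose that $F(0)=p$ and that $dF_0\ne0$ is conformal. Put $\Lambda=dF_0(\mathbb R^2)$, let $\pi_\Lambda:H\to\Lambda$ denote the orthogonal projection, and let $\lambda>0$ be the conformal factor of $dF_0$. Then $$\lambda\le\frac{1-|p|^2}{\sqrt{1-|p|^2+|\pi_\Lambda p|^2}}.$$ The estimate is sharp. Equality holds if and only if $F$ is a conformal or anticonformal diffeomorphism of $\mathbb D$ onto the affine disk $(p+\Lambda)\cap\mathbb B_H$.
   Context: $\mathbb D$ is the open unit disk in $\mathbb C$. A $C^2$ map $F:\mathbb D\to H$ is harmonic if $\Delta F=0$. A nonzero real differential $dF_0:\mathbb R^2\to H$ is conformal with conformal factor $\lambda>0$ if $|dF_0v|=\lambda|v|$ for all $v\in\mathbb R^2$. Conformal/anticonformal diffeomorphisms onto the planar disk $(p+\Lambda)\cap\mathbb B_H$ are understood after identifying the affine plane $p+\Lambda$ with $\mathbb C$ via Euclidean (orthonormal) coordinates: biholomorphic, respectively anti-biholomorphic, maps. Sharp means that for every $p\in\mathbb B_H$ and every real two-dimensional subspace $\Lambda$ the bound is attained by some such $F$. *)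

(* Defs.v *)
From HB Require Import structures.
From mathcomp Require Import all_boot all_order all_algebra.
From mathcomp Require Import all_classical all_reals all_analysis.
From mathcomp Require Import complex.
Set Implicit Arguments.
Unset Strict Implicit.
Unset Printing Implicit Defensive.
Import Order.TTheory GRing.Theory Num.Theory.
Import numFieldNormedType.Exports.
Local Open Scope classical_set_scope.
Local Open Scope ring_scope.

(* A real Hilbert space is a complete normed module [H] over [R] together with
   a positive definite symmetric bilinear form [dot : {dot H for idfun}] such
   that [`|x| ^+ 2 = dot x x]. *)

(* The norm of the normed module [R * R] is the max norm, hence the explicit
   Euclidean one; both give the same topology and derivatives. *)
Definition eucl_norm (R : realType) (v : R * R) : R :=
  Num.sqrt (v.1 ^+ 2 + v.2 ^+ 2).

Definition unit_disk (R : realType) : set (R * R) :=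
  [set z | eucl_norm z < 1].

Section HarmonicMaps.
Variables (R : realType) (H : normedModType R).

(* Strong continuity of [z |-> 'd F z] is the same as continuity in operator
   norm, the source being finite dimensional. Maps are total functions on
   [R * R]; for [U] open, only their values on [U] matter. *)
Definition C1_on (U : set (R * R)) (F : R * R -> H) : Prop :=
  forall z, U z ->
    differentiable F z /\ forall v, {for z, continuous ('D_v F)}.

Definition C2_on (U : set (R * R)) (F : R * R -> H) : Prop :=
  C1_on U F /\ forall v, C1_on U ('D_v F).

Definition laplacian (F : R * R -> H) (z : R * R) : H :=
  'D_(1, 0) ('D_(1, 0) F) z + 'D_(0, 1) ('D_(0, 1) F) z.

Definition harmonic_on (U : set (R * R)) (F : R * R -> H) : Prop :=
  C2_on U F /\ forall z, U z -> laplacian F z = 0.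

Definition conformal_with_factor (L : R * R -> H) (lam : R) : Prop :=
  [/\ exists v, L v != 0,
      0 < lam
    & forall v, `|L v| = lam * eucl_norm v].

Definition lin_indep2 (a b : H) : Prop :=
  forall s t : R, s *: a + t *: b = 0 -> s = 0 /\ t = 0.

Definition span2 (a b : H) : set H :=
  [set x | exists s t : R, x = s *: a + t *: b].

Definition is_plane (L : set H) : Prop :=
  exists a b, lin_indep2 a b /\ L = span2 a b.

(* [(p + L)] intersected with the open unit ball *)
Definition affine_disk (p : H) (L : set H) : set H :=
  [set x | L (x - p) /\ `|x| < 1].

End HarmonicMaps.

Section ComplexMaps.
Variable R : realType.

(* Differentiability is over the field [R[i]], i.e. complex. *)
Definition holomorphic_on (U : set R[i]) (f : R[i] -> R[i]) : Prop :=
  forall z, U z -> derivable (f : R[i]^o -> R[i]^o) z 1.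

Definition antiholomorphic_on (U : set R[i]) (f : R[i] -> R[i]) : Prop :=
  holomorphic_on U (fun z => conjc (f z)).

Definition biholomorphic (U V : set R[i]) (f : R[i] -> R[i]) : Prop :=
  [/\ set_bij U V f,
      holomorphic_on U f
    & exists g, {in U, cancel f g} /\ holomorphic_on V g].

Definition antibiholomorphic (U V : set R[i]) (f : R[i] -> R[i]) : Prop :=
  [/\ set_bij U V f,
      antiholomorphic_on U f
    & exists g, {in U, cancel f g} /\ antiholomorphic_on V g].

Definition pair_of_complex (z : R[i]) : R * R := (complex.Re z, complex.Im z).

End ComplexMaps.

Section Planes.
Variables (R : realType) (H : normedModType R) (dot : {dot H for idfun}).

Definition orthonormal_basis2 (L : set H) (e1 e2 : H) : Prop :=
  [/\ dot e1 e1 = 1, dot e2 e2 = 1, dot e1 e2 = 0 & L = span2 e1 e2].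

(* The orthogonal projection of [x] on [L], characterized by [y \in L] and
   [x - y] orthogonal to [L]; the default value [0] is never used when [L] is
   a plane. *)
Definition orth_proj (L : set H) (x : H) : H :=
  xget 0 [set y | L y /\ forall z, L z -> dot (x - y) z = 0].

Definition conformal_bound (p : H) (L : set H) : R :=
  (1 - `|p| ^+ 2) / Num.sqrt (1 - `|p| ^+ 2 + `|orth_proj L p| ^+ 2).

(* The identification of [p + span2 e1 e2] with the complex plane, for
   orthonormal [e1], [e2]. *)
Definition plane_coord (p e1 e2 x : H) : R[i] :=
  Complex (dot (x - p) e1) (dot (x - p) e2).

Definition in_coord (p e1 e2 : H) (F : R * R -> H) (z : R[i]) : R[i] :=
  plane_coord p e1 e2 (F (pair_of_complex z)).

(* [e1], [e2] is meant to be an orthonormal basis of [L]. Changing the basis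
   may exchange the next two notions, but does not affect their disjunction. *)
Definition conformal_diffeo (p : H) (L : set H) (e1 e2 : H)
    (F : R * R -> H) : Prop :=
  set_bij (@unit_disk R) (affine_disk p L) F /\
  biholomorphic (@pair_of_complex R @^-1` @unit_disk R)
    (plane_coord p e1 e2 @` affine_disk p L) (in_coord p e1 e2 F).

Definition anticonformal_diffeo (p : H) (L : set H) (e1 e2 : H)
    (F : R * R -> H) : Prop :=
  set_bij (@unit_disk R) (affine_disk p L) F /\
  antibiholomorphic (@pair_of_complex R @^-1` @unit_disk R)
    (plane_coord p e1 e2 @` affine_disk p L) (in_coord p e1 e2 F).

End Planes.

(* Main.v *)
Require Import Defs.
From HB Require Import structures.
From mathcomp Require Import all_boot all_order all_algebra.
From mathcomp Require Import all_classical all_reals all_analysis.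
From mathcomp Require Import complex.
From mathcomp Require Import ring lra.
Set Implicit Arguments.
Unset Strict Implicit.
Unset Printing Implicit Defensive.
Import Order.TTheory GRing.Theory Num.Theory.
Import numFieldNormedType.Exports.
Local Open Scope classical_set_scope.
Local Open Scope ring_scope.

(** The estimate compares [F] with an explicit conformal parametrization of the
    affine disk. Choose an orthonormal basis [u1], [u2] of [L] in which
    ['d F 0] is [lam] times the identity, write [p = c + q] with [q] in [L] and
    [c] orthogonal to [L], and put [rho ^+ 2 = 1 - `|c| ^+ 2], [q = rho a] with
    [a] a complex number. The map [f = c + rho M], where
    [M z = (z + a) / (1 + a^* z)], parametrizes the disk [(p + L)] of radius
    [rho], satisfies [f 0 = p], and has derivative [rho (1 - `|a| ^+ 2)] at the
    origin; this number is the bound of the theorem.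

    On the unit circle [`|f| = 1], so [dot (F (r z)) (f z) <= 1] for [r < 1].
    Multiplying by the weight [w z = `|1 + a^* z| ^+ 2 > 0] turns [f] into a
    trigonometric polynomial of degree one ([weight_extremal]), so the integral
    over the circle of [w (1 - dot (F (r z)) (f z))] only involves the Fourier
    coefficients of [F] of order zero and one, that is, [F 0] and ['d F 0]. It
    equals [2 pi rho (rho (1 - `|a| ^+ 2) - r lam)] ([gapE]); as it is
    nonnegative, letting [r] tend to one gives the estimate ([competitor_le]).

    If equality holds the integral tends to zero as [r] tends to one. It controls
    the mean of [`|F (r z) - f z| ^+ 2], and the same applies to [f] itself, so
    the means of the squared components of [F - f] over the circles of radius
    [r] tend to zero. These means are nondecreasing in [r] because the square of
    a harmonic function is subharmonic; hence they vanish and [F = f]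
    ([competitor_unique]). The map [f] is a conformal diffeomorphism
    ([extremal_conformal]), which also settles sharpness ([extremal_sharp]).

    Conversely, let [F] be biholomorphic onto the disk, with inverse [g] in
    coordinates. Then [g (rho (M - a))] is a holomorphic self-map of the unit
    disk fixing the origin, with derivative of modulus
    [rho (1 - `|a| ^+ 2) / lam] there. As a harmonic map into the unit ball it
    obeys the estimate already proved, which here is the Schwarz lemma, so the
    bound is at most [lam] ([conformal_diffeo_factor_ge]). The anticonformal case
    reduces to the conformal one by replacing [e2] with [- e2]
    ([anticonformalE]).

    The Fourier coefficients come from an ordinary differential equation: in
    polar coordinates the circular averages of a function of class C2 against
    [1], [cos] and [sin] satisfy such an equation in the radius ([circ_radial]),
    which is solved by hand for harmonic functions. It also shows that the
    averages of subharmonic functions are nondecreasing. *)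


(** * Integrals of continuous functions over one turn *)

Section TurnIntegral.
Context {R : realType}.
Implicit Types f g : R -> R.

Definition turn_int f : R :=
  (\int[lebesgue_measure]_(t in `[0, pi *+ 2]) f t)%R.

Let twopi_gt0 : (0 : R) < pi *+ 2.
Proof. by rewrite mulrn_wgt0// pi_gt0. Qed.

Lemma turn_integrable f : continuous f ->
  (@lebesgue_measure R).-integrable `[0, pi *+ 2] (EFin \o f).
Proof.
move=> cf; apply: continuous_compact_integrable; first exact: segment_compact.
exact: continuous_subspaceT.
Qed.

Lemma turn_intD f g : continuous f -> continuous g ->
  turn_int (fun t => f t + g t) = turn_int f + turn_int g.
Proof. by move=> cf cg; rewrite /turn_int RintegralD//; exact: turn_integrable. Qed.

Lemma turn_intZ (k : R) f : continuous f ->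
  turn_int (fun t => k * f t) = k * turn_int f.
Proof. by move=> cf; rewrite /turn_int RintegralZl//; exact: turn_integrable. Qed.

Lemma le_turn_int f g : continuous f -> continuous g ->
  (forall t, f t <= g t) -> turn_int f <= turn_int g.
Proof. by move=> cf cg fg; rewrite /turn_int le_Rintegral//; exact: turn_integrable. Qed.

Lemma turn_int_ge0 f : (forall t, 0 <= f t) -> 0 <= turn_int f.
Proof. by move=> f0; apply: Rintegral_ge0. Qed.

Lemma eq_turn_int f g : f =1 g -> turn_int f = turn_int g.
Proof. by move=> /funext ->. Qed.

Lemma turn_int_deriv f f' : (forall t : R, is_derive t 1 f (f' t)) ->
  continuous f' -> turn_int f' = f (pi *+ 2) - f 0.
Proof.
move=> df cf'; rewrite /turn_int /Rintegral (continuous_FTC2 (F := f))//.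
- exact: continuous_subspaceT.
- have cf : continuous f.
    by move=> x; apply: differentiable_continuous; apply/derivable1_diffP.
  split=> //.
  + by apply: cvg_at_right_filter; exact: cf.
  + by apply: cvg_at_left_filter; exact: cf.
- by move=> x _; rewrite derive1E derive_val.
Qed.

(** At a point where [f] is positive it exceeds half its value on a small
    interval, which already contributes a positive amount to the integral. *)
Lemma turn_int_eq0_inside f : continuous f -> (forall t, 0 <= f t) ->
  turn_int f = 0 -> forall t, 0 < t < pi *+ 2 -> f t = 0.
Proof.
move=> cf f0 if0 t /andP[t0 t2].
apply/eqP; rewrite eq_le f0 andbT leNgt; apply/negP => ft.
have [e /= e0 He] : \forall x \near t, f t / 2 < f x.
  have := cf t; move/cvgrPdist_lt => /(_ (f t / 2)); rewrite divr_gt0// => /(_ isT).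
  apply: filterS => x; rewrite ltr_norml => /andP[_]; lra.
pose d := Num.min (e / 2) (Num.min t (pi *+ 2 - t)).
have d0 : 0 < d by rewrite !lt_min divr_gt0// t0 subr_gt0.
have dle : [/\ d <= e / 2, d <= t & d <= pi *+ 2 - t].
  by rewrite /d !ge_min !lexx !orbT.
have sub : `[t - d/2, t + d/2] `<=` `[0, pi *+ 2].
  move=> x; rewrite /= !in_itv/=; case: dle; lra.
have intd : (@lebesgue_measure R).-integrable `[t - d/2, t + d/2] (EFin \o f).
  apply: continuous_compact_integrable; first exact: segment_compact.
  exact: continuous_subspaceT.
have : \int[lebesgue_measure]_(x in `[t - d/2, t + d/2]) (f t / 2) <= turn_int f.
  apply: (@le_trans _ _ (\int[lebesgue_measure]_(x in `[t - d/2, t + d/2]) f x)).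
    apply: le_Rintegral => //.
    - apply: continuous_compact_integrable; first exact: segment_compact.
      by apply: continuous_subspaceT => x; exact: cvg_cst.
    - move=> x; rewrite /= in_itv/= => xt; apply/ltW/He => /=.
      rewrite ltr_norml; case: dle; lra.
  rewrite /turn_int /Rintegral fine_le//.
  - exact: integrable_fin_num.
  - by apply: integrable_fin_num => //; exact: turn_integrable.
  - apply: ge0_subset_integral => //.
      by have /integrableP[] := turn_integrable cf.
    by move=> x _; rewrite lee_fin.
rewrite Rintegral_cst//= if0 lebesgue_measure_itv/= lte_fin.
have -> : t - d / 2 < t + d / 2 by lra.
rewrite /= leNgt => /negP; apply.
apply: mulr_gt0; lra.
Qed.

Lemma turn_int_eq0 f : continuous f ->
  (forall t, 0 <= f t) -> turn_int f = 0 -> forall t, 0 <= t < pi *+ 2 -> f t = 0.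
Proof.
move=> cf f0 if0 t /andP[]; rewrite le_eqVlt => /predU1P[<- _|t0 t2]; last first.
  by apply: turn_int_eq0_inside => //; rewrite t0.
apply/eqP; rewrite eq_le f0 andbT leNgt; apply/negP => fp.
have [e /= e0 He] : \forall x \near (0 : R), 0 < f x.
  have := cf 0; move/cvgrPdist_lt => /(_ (f 0) fp).
  apply: filterS => x; rewrite ltr_norml => /andP[_]; lra.
have p0 := @pi_gt0 R.
pose d := Num.min (e / 2) pi.
have d0 : 0 < d by rewrite lt_min divr_gt0.
have dle : d <= e / 2 /\ d <= pi by rewrite /d !ge_min !lexx !orbT.
have : 0 < f d.
  by apply: He; rewrite /= sub0r normrN gtr0_norm//; lra.
by rewrite (turn_int_eq0_inside cf f0 if0) ?ltxx// mulr2n; lra.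
Qed.

End TurnIntegral.


(** * Gradients, and differentiation under the integral sign *)

Section Gradients.
Context {R : realType}.

Definition has_grad (W : normedModType R) (U : set (R * R))
    (f fx fy : R * R -> W) :=
  forall z, U z -> is_diff z f (fun h => h.1 *: fx z + h.2 *: fy z).

Lemma is_diff_derive (V W : normedModType R) (f df : V -> W) x v :
  is_diff x f df -> is_derive x v f (df v).
Proof.
move=> fdf; split; first exact: diff_derivable.
by rewrite deriveE// diff_val.
Qed.

Lemma is_derive_diff (W : normedModType R) (f : R -> W) (x : R) d :
  is_derive x 1 f d -> is_diff x f (fun h => h *: d).
Proof.
move=> fd; have df : derivable f x 1 by [].
split; first exact/derivable1_diffP.
by rewrite deriv1E// derive1E derive_val.
Qed.

Lemma is_derive_along (W : normedModType R) (v : R * R -> W) (a b : R -> R)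
    (t : R) (a' b' : R) vx vy :
  is_diff (a t, b t) v (fun h => h.1 *: vx + h.2 *: vy) ->
  is_derive t 1 a a' -> is_derive t 1 b b' ->
  is_derive t 1 (fun s => v (a s, b s)) (a' *: vx + b' *: vy).
Proof.
move=> dv /is_derive_diff da /is_derive_diff db.
have dab : is_diff t (fun s => (a s, b s)) (fun h => (h *: a', h *: b')).
  exact: is_diff_pair.
have := is_diff_derive (1 : R) (is_diff_comp dab dv).
by rewrite /= !scale1r.
Qed.

Lemma has_grad_continuous (W : normedModType R) U (f fx fy : R * R -> W) z :
  has_grad U f fx fy -> U z -> {for z, continuous f}.
Proof. by move=> fg Uz; have := fg z Uz => ?; apply: differentiable_continuous. Qed.

End Gradients.

Section DerivUnderTurn.
Context {R : realType}.

(** On a compact box the continuous function [dG] is bounded by a constant,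
    which serves as the dominating function for differentiation under the
    integral sign. *)
Lemma turn_int_param (G dG : R -> R -> R) (a : R) :
  -1 < a < 1 ->
  (forall r : R, -1 < r < 1 -> continuous (G r)) ->
  (forall r t : R, -1 < r < 1 -> is_derive r 1 (G ^~ t) (dG r t)) ->
  (forall r t : R, -1 < r < 1 ->
    {for (r, t), continuous (fun p : R * R => dG p.1 p.2)}) ->
  is_derive a 1 (fun r => turn_int (G r)) (turn_int (dG a)).
Proof.
move=> a1 cG dGE cdG.
have [b ab b1] : exists2 b, -b < a < b & b < 1.
  exists ((1 + `|a|) / 2); have : `|a| < 1 by rewrite ltr_norml.
    move: (ler_norm a) (ler_norm (- a)); rewrite normrN; lra.
  lra.
pose K := [set p : R * R | `[-b, b]%classic p.1 /\ `[0, pi *+ 2]%classic p.2].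
have cK : compact K by apply: compact_setX; exact: segment_compact.
have K0 : K !=set0.
  exists (0, 0); split; rewrite /= in_itv/=; first lra.
  by rewrite lexx mulrn_wge0// pi_ge0.
have [] := @compact_EVT_max _ _ (fun p : R * R => `|dG p.1 p.2|) K K0 cK.
  apply/continuous_in_subspaceT => p /set_mem [].
  rewrite /= !in_itv/= => p1 _.
  have -> : p = (p.1, p.2) by case: p {p1}.
  by apply: (continuous_comp (cdG p.1 p.2 _)); [lra|exact: norm_continuous].
move=> m _ mmax.
have I1 : forall x, `]-b, b[%classic x -> -1 < x < 1.
  by move=> x; rewrite /= in_itv/=; lra.
have dd x y : `]-b, b[%classic x -> partial1of2 G x y = dG x y.
  by move=> /I1 x1; rewrite partial1of2E; have := dGE x y x1 => ?; rewrite derive_val.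
have Ia : `]-b, b[%classic a by rewrite /= in_itv/=.
have h2 x : `]-b, b[%classic x ->
  (@lebesgue_measure R).-integrable `[0, pi *+ 2] (EFin \o G x).
  by move=> /I1 x1; apply: turn_integrable; exact: cG.
have h3 x y : `]-b, b[%classic x -> `[0, pi *+ 2]%classic y -> derivable (G ^~ y) x 1.
  by move=> /I1 x1 _; have := dGE x y x1.
have h4 : (@lebesgue_measure R).-integrable `[0, pi *+ 2]
    (EFin \o (fun=> `|dG m.1 m.2|)).
  by apply: turn_integrable => x; exact: cvg_cst.
have h5 x y : `]-b, b[%classic x -> `[0, pi *+ 2]%classic y ->
    `|partial1of2 G x y| <= `|dG m.1 m.2|.
  move=> Ix Iy; rewrite dd//; have /= := mmax (x, y); apply.
  by apply/mem_set; split => //=; move: Ix; rewrite /= !in_itv/=; lra.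
have h6 (y : R) : 0 <= `|dG m.1 m.2| by [].
have mI : measurable (`[(0:R), pi *+ 2]%classic : set (measurableTypeR R)).
  exact: measurable_itv.
split.
  exact: (@derivable_under_integral R _ _ lebesgue_measure G
    `[0, pi *+ 2]%classic mI a (- b) b Ia h2 h3 _ h6 h4 h5).
rewrite -derive1E /turn_int (@differentiation_under_integral R _ _
  lebesgue_measure G `[0, pi *+ 2]%classic mI a (- b) b Ia h2 h3 _ h6 h4 h5).
by apply: eq_Rintegral => x _ /=; rewrite dd.
Qed.

End DerivUnderTurn.


(** * Weighted averages over circles *)

Section CircleMeans.
Context {R : realType}.
Implicit Types (v : R * R -> R) (c : R -> R) (r t : R).

Local Notation U := (@unit_disk R).

(** The radius may be negative: circular averages are then defined and
    differentiable on the whole interval from [-1] to [1], across the centre. *)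
Definition polar r t : R * R := (r * cos t, r * sin t).

Lemma unit_diskE (z : R * R) : U z = (z.1 ^+ 2 + z.2 ^+ 2 < 1) :> Prop.
Proof.
rewrite /unit_disk /eucl_norm /=; congr is_true.
by rewrite -[in LHS](sqrtr1 R) ltr_sqrt.
Qed.

Lemma polar_norm r t : (polar r t).1 ^+ 2 + (polar r t).2 ^+ 2 = r ^+ 2.
Proof. by rewrite /= !exprMn -mulrDr cos2Dsin2 mulr1. Qed.

Lemma polar_disk r t : -1 < r < 1 -> U (polar r t).
Proof.
move=> r1; rewrite unit_diskE polar_norm expr2; nra.
Qed.

Lemma is_derive_polar v vx vy r t : U (polar r t) -> has_grad U v vx vy ->
  is_derive r 1 (fun s => v (polar s t))
    (cos t * vx (polar r t) + sin t * vy (polar r t)) /\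
  is_derive t 1 (fun s => v (polar r s))
    (r * (- sin t * vx (polar r t) + cos t * vy (polar r t))).
Proof.
move=> Uz gv; have dv := gv _ Uz; split.
  apply: (is_derive_along dv (a := fun s => s * cos t) (b := fun s => s * sin t)).
  - by apply: is_derive_eq; rewrite scaler0 add0r /GRing.scale/= mulr1.
  - by apply: is_derive_eq; rewrite scaler0 add0r /GRing.scale/= mulr1.
have -> : r * (- sin t * vx (polar r t) + cos t * vy (polar r t)) =
   (r * - sin t) *: vx (polar r t) + (r * cos t) *: vy (polar r t).
  by rewrite /GRing.scale/=; ring.
exact: (is_derive_along dv (a := fun s => r * cos s) (b := fun s => r * sin s)).
Qed.

Lemma continuous_pair_for (T : topologicalType) (f g : T -> R) x :
  {for x, continuous f} -> {for x, continuous g} ->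
  {for x, continuous (fun y => (f y, g y))}.
Proof. exact: cvg_pair. Qed.

Lemma fst_continuous : continuous (@fst R R).
Proof. by case=> a b; exact: cvg_fst. Qed.

Lemma snd_continuous : continuous (@snd R R).
Proof. by case=> a b; exact: cvg_snd. Qed.

Lemma polar_continuous : continuous (fun p : R * R => polar p.1 p.2).
Proof.
move=> p; apply: (@continuous_pair_for _ (fun p : R * R => p.1 * cos p.2)
  (fun p : R * R => p.1 * sin p.2)); apply: cvgM; try exact: fst_continuous.
- by apply: (continuous_comp (@snd_continuous p)); exact: continuous_cos.
- by apply: (continuous_comp (@snd_continuous p)); exact: continuous_sin.
Qed.

Definition circ v c r : R := turn_int (fun t => v (polar r t) * c t).

Lemma polar_continuous_angle r : continuous (polar r).
Proof.
move=> t; have : {for t, continuous (fun s => (r, s))}.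
  by apply: (@continuous_pair_for R (fun=> r) id t); [exact: cvg_cst|exact: cvg_id].
by move=> h; exact: (continuous_comp h (@polar_continuous (r, t))).
Qed.

Lemma circ_integrand_continuous v c r : (forall z, U z -> {for z, continuous v}) ->
  continuous c -> -1 < r < 1 -> continuous (fun t => v (polar r t) * c t).
Proof.
move=> cv cc r1 t; apply: cvgM; last exact: cc.
apply: (continuous_comp (@polar_continuous_angle r t)); exact/cv/polar_disk.
Qed.

Lemma circ_derive v vx vy c r : has_grad U v vx vy ->
  (forall z, U z -> {for z, continuous vx}) ->
  (forall z, U z -> {for z, continuous vy}) ->
  continuous c -> -1 < r < 1 ->
  is_derive r 1 (circ v c)
    (circ vx (fun t => cos t * c t) r + circ vy (fun t => sin t * c t) r).
Proof.
move=> gv cvx cvy cc r1.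
have ccos : continuous (fun t => cos t * c t).
  by move=> t; apply: cvgM; [exact: continuous_cos|exact: cc].
have csin : continuous (fun t => sin t * c t).
  by move=> t; apply: cvgM; [exact: continuous_sin|exact: cc].
pose dG s t := (cos t * vx (polar s t) + sin t * vy (polar s t)) * c t.
have -> : circ vx (fun t => cos t * c t) r + circ vy (fun t => sin t * c t) r =
  turn_int (dG r).
  rewrite /circ -turn_intD; try exact: circ_integrand_continuous.
  by apply: eq_turn_int => t; rewrite /dG; ring.
apply: (@turn_int_param R (fun s t => v (polar s t) * c t) dG r r1).
- move=> s s1; apply: circ_integrand_continuous => // z Uz; exact: has_grad_continuous gv Uz.
- move=> s t s1; have [dv _] := is_derive_polar (polar_disk t s1) gv.
  by apply: is_derive_eq; rewrite scaler0 add0r /GRing.scale /= /dG mulrC.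
- move=> s t s1.
  have csnd (f : R -> R) : continuous f -> {for (s, t), continuous (fun p => f p.2)}.
    by move=> cf; apply: (continuous_comp (@snd_continuous (s, t))); exact: cf.
  have cpol (f : R * R -> R) : (forall z, U z -> {for z, continuous f}) ->
      {for (s, t), continuous (fun p => f (polar p.1 p.2))}.
    move=> cf; apply: (continuous_comp (@polar_continuous (s, t))).
    exact/cf/polar_disk.
  apply: cvgM; last exact: csnd cc.
  apply: cvgD; apply: cvgM; [exact: csnd (@continuous_cos _)|exact: cpol|
     exact: csnd (@continuous_sin _)|exact: cpol].
Qed.

End CircleMeans.


(** * The radial equation *)

(** Keeping the partial derivatives as data makes it possible to transport them
    through sums, products and continuous linear maps. The second index of
    [fxy] is the direction of the second differentiation. *)
Record second_grad (R : realType) (W : normedModType R) (U : set (R * R))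
    (f fx fy fxx fxy fyx fyy : R * R -> W) : Prop := SecondGrad {
  grad_f : has_grad U f fx fy;
  grad_fx : has_grad U fx fxx fxy;
  grad_fy : has_grad U fy fyx fyy;
  cont_fxx : forall z, U z -> {for z, continuous fxx};
  cont_fxy : forall z, U z -> {for z, continuous fxy};
  cont_fyx : forall z, U z -> {for z, continuous fyx};
  cont_fyy : forall z, U z -> {for z, continuous fyy} }.

Section RadialEquation.
Context {R : realType}.
Implicit Types (v : R * R -> R) (c : R -> R) (r t : R).
Local Notation U := (@unit_disk R).

(** Integration by parts in the angle: the derivative of [v * b] along the circle
    integrates to zero by periodicity. *)
Lemma circ_parts v vx vy b b' r : has_grad U v vx vy ->
  (forall z, U z -> {for z, continuous vx}) ->
  (forall z, U z -> {for z, continuous vy}) ->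
  (forall t : R, is_derive t 1 b (b' t)) -> continuous b' ->
  b (pi *+ 2) = b 0 -> -1 < r < 1 ->
  circ v b' r + r * (circ vx (fun t => - sin t * b t) r +
                     circ vy (fun t => cos t * b t) r) = 0.
Proof.
move=> gv cvx cvy db cb' bper r1.
have cb : continuous b.
  by move=> t; apply: differentiable_continuous; apply/derivable1_diffP.
have ccos : continuous (fun t => cos t * b t).
  by move=> t; apply: cvgM; [exact: continuous_cos|exact: cb].
have csin : continuous (fun t => - sin t * b t).
  by move=> t; apply: cvgM; [apply: cvgN; exact: continuous_sin|exact: cb].
have cv z : U z -> {for z, continuous v} by move=> Uz; exact: has_grad_continuous gv Uz.
pose f' t := v (polar r t) * b' t +
  r * (vx (polar r t) * (- sin t * b t) + vy (polar r t) * (cos t * b t)).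
have cf1 := circ_integrand_continuous cvx csin r1.
have cf2 := circ_integrand_continuous cvy ccos r1.
have cf12 : continuous (fun t => vx (polar r t) * (- sin t * b t) +
   vy (polar r t) * (cos t * b t)).
  by move=> t; apply: cvgD; [exact: cf1|exact: cf2].
have cf3 := circ_integrand_continuous cv cb' r1.
have cf123 : continuous (fun t => r * (vx (polar r t) * (- sin t * b t) +
   vy (polar r t) * (cos t * b t))).
  by move=> t; apply: cvgM; [exact: cvg_cst|exact: cf12].
have cf' : continuous f' by move=> t; apply: cvgD; [exact: cf3|exact: cf123].
rewrite /circ -turn_intD// -turn_intZ// -turn_intD//.
have df' (t : R) : is_derive t 1 (fun t => v (polar r t) * b t) (f' t).
  have [_ dv] := is_derive_polar (polar_disk t r1) gv.
  by apply: is_derive_eq; rewrite /f' /GRing.scale/=; ring.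
by rewrite (turn_int_deriv df' cf') /polar cos2pi sin2pi cos0 sin0 bper subrr.
Qed.

Variables (v vx vy vxx vxy vyx vyy : R * R -> R).
Hypothesis v2 : second_grad U v vx vy vxx vxy vyx vyy.

Let cv z : U z -> {for z, continuous v}.
Proof. by move=> Uz; exact: has_grad_continuous (grad_f v2) Uz. Qed.
Let cvx z : U z -> {for z, continuous vx}.
Proof. by move=> Uz; exact: has_grad_continuous (grad_fx v2) Uz. Qed.
Let cvy z : U z -> {for z, continuous vy}.
Proof. by move=> Uz; exact: has_grad_continuous (grad_fy v2) Uz. Qed.

(** In polar coordinates [r d/dr] applied twice differs from [r ^+ 2] times the
    Laplacian by the second derivative in the angle. Integrating the latter
    against [c] by parts moves it onto [c], which is an eigenfunction with
    eigenvalue [- k]. The mixed derivatives only occur through their sum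
    [vxy + vyx], in both the radial and the angular second derivative. *)
Lemma circ_radial (c c' : R -> R) (k : R) :
  (forall t : R, is_derive t 1 c (c' t)) ->
  (forall t : R, is_derive t 1 c' (- k * c t)) ->
  c (pi *+ 2) = c 0 -> c' (pi *+ 2) = c' 0 ->
  exists A1 A2 : R -> R, forall r, -1 < r < 1 ->
    [/\ is_derive r 1 (circ v c) (A1 r),
        is_derive r 1 A1 (A2 r),
        A1 r = circ vx (fun t => cos t * c t) r +
               circ vy (fun t => sin t * c t) r
      & r * (r * A2 r + A1 r) =
        r ^+ 2 * circ (fun z => vxx z + vyy z) c r + k * circ v c r].
Proof.
move=> dc dc' cper c'per.
have cc : continuous c.
  by move=> t; apply: differentiable_continuous; apply/derivable1_diffP.
have cc' : continuous c'.
  by move=> t; apply: differentiable_continuous; apply/derivable1_diffP.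
have [ccos csin] := (@continuous_cos R, @continuous_sin R).
have cM (f g : R -> R) : continuous f -> continuous g ->
    continuous (fun t => f t * g t).
  by move=> cf cg t; apply: cvgM; [exact: cf|exact: cg].
have cD (f g : R -> R) : continuous f -> continuous g ->
    continuous (fun t => f t + g t).
  by move=> cf cg t; apply: cvgD; [exact: cf|exact: cg].
have cN (f : R -> R) : continuous f -> continuous (fun t => - f t).
  by move=> cf t; apply: cvgN; exact: cf.
have ccc := cM _ _ ccos cc; have csc := cM _ _ csin cc.
exists (fun r => circ vx (fun t => cos t * c t) r +
                 circ vy (fun t => sin t * c t) r).
exists (fun r => (circ vxx (fun t => cos t * (cos t * c t)) r +
                  circ vxy (fun t => sin t * (cos t * c t)) r) +
                 (circ vyx (fun t => cos t * (sin t * c t)) r +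
                  circ vyy (fun t => sin t * (sin t * c t)) r)).
case: v2 => gv gvx gvy cvxx cvxy cvyx cvyy r r1; split => //.
- exact: circ_derive.
- have d1 := circ_derive gvx cvxx cvxy ccc r1.
  have d2 := circ_derive gvy cvyx cvyy csc r1.
  exact: is_deriveD.
- have P1 := circ_parts gv cvx cvy dc' (cM _ _ (@cst_continuous _ _ (- k)) cc) c'per r1.
  have ds (t : R) : is_derive t 1 (fun t => - sin t * c t)
      (- cos t * c t + - sin t * c' t).
    by apply: is_derive_eq; rewrite /GRing.scale/=; ring.
  have dcs (t : R) : is_derive t 1 (fun t => cos t * c t)
      (- sin t * c t + cos t * c' t).
    by apply: is_derive_eq; rewrite /GRing.scale/=; ring.
  have P2 := circ_parts gvx cvxx cvxy ds
    (cD _ _ (cM _ _ (cN _ ccos) cc) (cM _ _ (cN _ csin) cc')).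
  have P3 := circ_parts gvy cvyx cvyy dcs
    (cD _ _ (cM _ _ (cN _ csin) cc) (cM _ _ ccos cc')).
  have {}P2 := P2 r _ r1; have {}P3 := P3 r _ r1.
  rewrite !sin2pi !sin0 !oppr0 !mul0r !cos2pi !cos0 !mul1r in P2 P3.
  have {}P2 := P2 erefl; have {}P3 := P3 cper.
  (* P1, P2, P3 are the integrations by parts for v, vx and vy with weights c',
     - sin c and cos c; after expanding all integrals into those of a partial
     derivative against a product of c or c' with powers of cos and sin, the
     claim is the combination P1 - r P2 - r P3 *)
  have E (f : R * R -> R) (a b d : R -> R) :
     (forall z, U z -> {for z, continuous f}) -> continuous a -> continuous b -> (forall t, d t = a t + b t) ->
     circ f d r = circ f a r + circ f b r.
    move=> cf ca cb dE; rewrite /circ -turn_intD; try exact: circ_integrand_continuous.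
    by apply: eq_turn_int => t; rewrite dE mulrDr.
  have EZ (f : R * R -> R) (a d : R -> R) (s : R) :
     (forall z, U z -> {for z, continuous f}) -> continuous a -> (forall t, d t = s * a t) -> circ f d r = s * circ f a r.
    move=> cf ca dE; rewrite /circ -turn_intZ; try exact: circ_integrand_continuous.
    by apply: eq_turn_int => t; rewrite dE mulrCA.
  have Ec f (a d : R -> R) : (forall t, d t = a t) -> circ f d r = circ f a r.
    by move=> /funext ->.
  have csc' := cM _ _ csin cc'; have ccc' := cM _ _ ccos cc'.
  rewrite (EZ v c _ (- k))// in P1.
  rewrite (EZ vx (fun t => sin t * c' t) _ (- 1))// in P1; last by move=> t; ring.
  rewrite (E vx (fun t => - (cos t * c t)) (fun t => - (sin t * c' t)))// in P2;
    [|exact: cN|exact: cN|by move=> t; ring].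
  rewrite (EZ vx (fun t => cos t * c t) (fun t => - (cos t * c t)) (- 1))// in P2;
    last by move=> t; ring.
  rewrite (EZ vx (fun t => sin t * c' t) (fun t => - (sin t * c' t)) (- 1))// in P2;
    last by move=> t; ring.
  rewrite (E vy (fun t => - (sin t * c t)) (fun t => (cos t * c' t)))// in P3;
    [|exact: cN|by move=> t; ring].
  rewrite (EZ vy (fun t => sin t * c t) (fun t => - (sin t * c t)) (- 1))// in P3;
    last by move=> t; ring.
  have EL : circ (fun z => vxx z + vyy z) c r = circ vxx c r + circ vyy c r.
    rewrite /circ -turn_intD; try exact: circ_integrand_continuous.
    by apply: eq_turn_int => t; rewrite mulrDl.
  have css := cM _ _ csin csc; have ccs := cM _ _ ccos csc.
  have ccs' := cM _ _ csin ccc; have ccc2 := cM _ _ ccos ccc.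
  have Exx : circ vxx c r = circ vxx (fun t => cos t * (cos t * c t)) r +
      circ vxx (fun t => sin t * (sin t * c t)) r.
    by apply: E => // t; rewrite -[LHS]mul1r -(cos2Dsin2 t); ring.
  have Eyy : circ vyy c r = circ vyy (fun t => cos t * (cos t * c t)) r +
      circ vyy (fun t => sin t * (sin t * c t)) r.
    by apply: E => // t; rewrite -[LHS]mul1r -(cos2Dsin2 t); ring.
  rewrite (Ec vxx (fun t => sin t * (sin t * c t))) in P2; last by move=> t; ring.
  rewrite (EZ vxy (fun t => sin t * (cos t * c t)) _ (- 1))// in P2; last by move=> t; ring.
  rewrite (EZ vyx (fun t => cos t * (sin t * c t)) _ (- 1))// in P3; last by move=> t; ring.
  rewrite EL Exx Eyy.
  have := congr1 ( *%R r) P2; have := congr1 ( *%R r) P3.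
  rewrite !mulr0 => Q3 Q2.
  lra.
Qed.

End RadialEquation.


(** * Fourier coefficients of harmonic functions *)

Section HarmonicMeans.
Context {R : realType}.
Implicit Types (v : R * R -> R) (c : R -> R) (r t : R).
Local Notation U := (@unit_disk R).

Lemma mean_value (f f' : R -> R) (a b : R) : a < b ->
  (forall x, a <= x <= b -> is_derive x 1 f (f' x)) ->
  exists2 x, a < x < b & f b - f a = f' x * (b - a).
Proof.
move=> ab df.
have dfi x : x \in `]a, b[ -> is_derive x 1 f (f' x).
  by rewrite in_itv/= => /andP[ax xb]; apply: df; rewrite !ltW.
have cf : {within `[a, b], continuous f}.
  apply: derivable_within_continuous => x; rewrite in_itv/= => xab.
  by have := df x xab.
have [x] := MVT ab dfi cf.
by rewrite in_itv/= => xab fE; exists x.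
Qed.

Lemma turn_int_cos2 : turn_int (fun t : R => cos t * cos t) = pi.
Proof.
have df (t : R) : is_derive t 1 (fun t => (t + sin t * cos t) / 2) (cos t * cos t).
  apply: is_derive_eq; rewrite /GRing.scale/=; have := cos2Dsin2 t; lra.
rewrite (turn_int_deriv df); last first.
  by move=> t; apply: cvgM; exact: continuous_cos.
rewrite sin2pi sin0 !mul0r; lra.
Qed.

Lemma turn_int_sin2 : turn_int (fun t : R => sin t * sin t) = pi.
Proof.
have df (t : R) : is_derive t 1 (fun t => (t - sin t * cos t) / 2) (sin t * sin t).
  apply: is_derive_eq; rewrite /GRing.scale/=; have := cos2Dsin2 t; lra.
rewrite (turn_int_deriv df); last first.
  by move=> t; apply: cvgM; exact: continuous_sin.
rewrite sin2pi sin0 !mul0r; lra.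
Qed.

Lemma turn_int_sincos : turn_int (fun t : R => sin t * cos t) = 0.
Proof.
have df (t : R) : is_derive t 1 (fun t => sin t * sin t / 2) (sin t * cos t).
  apply: is_derive_eq; rewrite /GRing.scale/=; lra.
rewrite (turn_int_deriv df); last first.
  by move=> t; apply: cvgM; [exact: continuous_sin|exact: continuous_cos].
by rewrite sin2pi sin0 !mul0r subrr.
Qed.

Lemma turn_int_cst (k : R) : turn_int (fun=> k) = pi *+ 2 * k.
Proof.
have df (t : R) : is_derive t 1 (fun t => t * k) k.
  by apply: is_derive_eq; rewrite /GRing.scale/=; ring.
by rewrite (turn_int_deriv df) ?mul0r ?subr0// => t; exact: cvg_cst.
Qed.

Section Means.
Variables (v vx vy vxx vxy vyx vyy : R * R -> R).
Hypothesis v2 : second_grad U v vx vy vxx vxy vyx vyy.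

Let radial1 : exists A1 A2 : R -> R, forall r, -1 < r < 1 ->
    [/\ is_derive r 1 (circ v (cst 1)) (A1 r),
        is_derive r 1 A1 (A2 r)
      & r * (r * A2 r + A1 r) =
        r ^+ 2 * circ (fun z => vxx z + vyy z) (cst 1) r].
Proof.
have d1 (t : R) : is_derive t 1 (cst 1 : R -> R) (cst 0 t) by exact: is_derive_cst.
have d0 (t : R) : is_derive t 1 (cst 0 : R -> R) (- 0 * cst 1 t).
  by apply: is_derive_eq; rewrite oppr0 mul0r.
have [A1 [A2 A12]] := circ_radial v2 d1 d0 erefl erefl.
exists A1, A2 => r r1; have [? ? _ ->] := A12 r r1; split => //.
by rewrite mul0r addr0.
Qed.

(** The flux [r A1 r] of the gradient vanishes at the centre and has derivative
    [r] times the circular integral of the Laplacian; the mean value theorem transfers the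
    sign of the Laplacian to the slope of the mean. *)
Let slope1 (A1 A2 : R -> R) r : (forall r, -1 < r < 1 ->
    [/\ is_derive r 1 (circ v (cst 1)) (A1 r),
        is_derive r 1 A1 (A2 r)
      & r * (r * A2 r + A1 r) =
        r ^+ 2 * circ (fun z => vxx z + vyy z) (cst 1) r]) ->
  0 < r < 1 -> exists2 s, 0 < s < 1 &
    A1 r = s * circ (fun z => vxx z + vyy z) (cst 1) s.
Proof.
move=> A12 /andP[r0 r1].
have dB x : 0 <= x <= r -> is_derive x 1 (fun s => s * A1 s) (x * A2 x + A1 x).
  move=> xr; have [|_ dA1 _] := A12 x; first lra.
  by apply: is_derive_eq; rewrite /GRing.scale/=; ring.
have [s sr sE] := mean_value r0 dB.
exists s; first lra.
have [|_ _ Es] := A12 s; first lra.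
have s0 : s != 0 by lra.
apply: (mulfI (_ : r != 0)); first lra.
move: sE; rewrite mul0r !subr0 => ->.
rewrite mulrC; congr (r * _); apply: (mulfI s0).
by rewrite Es; ring.
Qed.

Lemma subharmonic_mean_le r s : (forall z, U z -> 0 <= vxx z + vyy z) ->
  0 <= r <= s -> s < 1 -> circ v (cst 1) r <= circ v (cst 1) s.
Proof.
move=> lap /andP[r0]; rewrite le_eqVlt => /predU1P[->//|rs] s1.
have [A1 [A2 A12]] := radial1.
have dA x : r <= x <= s -> is_derive x 1 (circ v (cst 1)) (A1 x).
  by move=> xrs; have [|//] := A12 x; lra.
have [x xrs E] := mean_value rs dA.
rewrite -subr_ge0 E mulr_ge0//; last lra.
have [|y y1 ->] := slope1 (r := x) A12; first lra.
apply: mulr_ge0; first lra.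
apply: turn_int_ge0 => t; rewrite mulr1; apply/lap/polar_disk; lra.
Qed.

Hypothesis lap0 : forall z, U z -> vxx z + vyy z = 0.

Let circ_lap0 c r : -1 < r < 1 -> circ (fun z => vxx z + vyy z) c r = 0.
Proof.
move=> r1; rewrite /circ (eq_turn_int (g := fun=> 0)).
  by rewrite turn_int_cst mulr0.
by move=> t; rewrite lap0 ?mul0r//; exact: polar_disk.
Qed.

Let circ0 c : continuous c -> circ v c 0 = v 0 * turn_int c.
Proof.
move=> cc; rewrite -turn_intZ//; apply: eq_turn_int => t.
by rewrite /polar !mul0r.
Qed.

Lemma harmonic_circ_mean r : 0 <= r < 1 -> circ v (cst 1) r = pi *+ 2 * v 0.
Proof.
move=> /andP[]; rewrite le_eqVlt => /predU1P[<- _|r0 r1].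
  by rewrite circ0 ?turn_int_cst ?mulr1 1?mulrC//; exact: cst_continuous.
have [A1 [A2 A12]] := radial1.
have dA x : 0 <= x <= r -> is_derive x 1 (circ v (cst 1)) (A1 x).
  by move=> xrs; have [|//] := A12 x; lra.
have [x xrs] := mean_value r0 dA.
have [|y y1 ->] := slope1 (r := x) A12; first lra.
rewrite circ_lap0 ?mulr0 ?mul0r; last lra.
move/eqP; rewrite subr_eq0 => /eqP->.
by rewrite circ0 ?turn_int_cst ?mulr1 1?mulrC//; exact: cst_continuous.
Qed.

(** For [k = 1] the equation says that [x (x A1 - A)] is constant, hence zero;
    feeding this back gives [A2 = 0], so [A1] keeps its value at the centre,
    which is given by the gradient there. *)
Let first_coef c c' r : (forall t : R, is_derive t 1 c (c' t)) ->
  (forall t : R, is_derive t 1 c' (- 1 * c t)) ->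
  c (pi *+ 2) = c 0 -> c' (pi *+ 2) = c' 0 -> 0 <= r < 1 ->
  circ v c r = r * (vx 0 * turn_int (fun t => cos t * c t) +
                    vy 0 * turn_int (fun t => sin t * c t)).
Proof.
move=> dc dc' cper c'per /andP[r0 r1].
have cc : continuous c.
  by move=> t; apply: differentiable_continuous; apply/derivable1_diffP.
have [A1 [A2 A12]] := circ_radial v2 dc dc' cper c'per.
have A10 : A1 0 = vx 0 * turn_int (fun t => cos t * c t) +
                  vy 0 * turn_int (fun t => sin t * c t).
  have [|_ _ -> _] := A12 0; first lra.
  rewrite -!turn_intZ.
  - by congr (_ + _); apply: eq_turn_int => t; rewrite /polar !mul0r.
  - by move=> t; apply: cvgM; [exact: continuous_sin|exact: cc].
  - by move=> t; apply: cvgM; [exact: continuous_cos|exact: cc].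
rewrite -A10 {A10}.
have ode x : -1 < x < 1 -> x * (x * A2 x + A1 x) = circ v c x.
  move=> x1; have [_ _ _ ->] := A12 x x1.
  by rewrite circ_lap0// mulr0 add0r mul1r.
have key x : 0 <= x < 1 -> x * (x * A1 x - circ v c x) = 0.
  move=> /andP[]; rewrite le_eqVlt => /predU1P[<- _|x0 x1]; first by rewrite mul0r.
  have dB y : 0 <= y <= x -> is_derive y 1 (fun s => s * (s * A1 s - circ v c s)) 0.
    move=> yx; have y1 : -1 < y < 1 by lra.
    have [dA dA1 _ _] := A12 y y1.
    apply: is_derive_eq; rewrite /GRing.scale/=.
    have := ode y y1; lra.
  have [y _] := mean_value x0 dB.
  by rewrite !mul0r subr0.
have key2 x : 0 <= x < 1 -> circ v c x = x * A1 x.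
  move=> x1; have [->|x0] := eqVneq x 0.
    by rewrite -ode ?mul0r//; lra.
  by have /eqP := key x x1; rewrite mulf_eq0 (negbTE x0)/= subr_eq0 => /eqP.
rewrite key2 ?r0//; congr (r * _).
move: r0; rewrite le_eqVlt => /predU1P[<-//|r0].
have dA y : 0 <= y <= r -> is_derive y 1 A1 (A2 y).
  by move=> yr; have [|//] := A12 y; lra.
have [y yr] := mean_value r0 dA.
suff -> : A2 y = 0 by rewrite mul0r => /eqP; rewrite subr_eq0 => /eqP.
have y1 : -1 < y < 1 by lra.
have := ode y y1; rewrite key2; last lra.
have y0 : y != 0 by lra.
move=> E; apply: (mulfI y0); apply: (mulfI y0); move: E; rewrite !mulr0; lra.
Qed.

Lemma harmonic_cos_coef r : 0 <= r < 1 -> circ v cos r = pi * r * vx 0.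
Proof.
move=> r1.
have ds (t : R) : is_derive t 1 (fun t => - sin t) (- 1 * cos t).
  by apply: is_derive_eq; ring.
have pc : cos (pi *+ 2) = cos (0 : R) by rewrite cos2pi cos0.
have ps : - sin (pi *+ 2) = - sin (0 : R) by rewrite sin2pi sin0.
rewrite (first_coef (@is_derive_cos R) ds pc ps r1) turn_int_cos2 turn_int_sincos.
ring.
Qed.

Lemma harmonic_sin_coef r : 0 <= r < 1 -> circ v sin r = pi * r * vy 0.
Proof.
move=> r1.
have dc (t : R) : is_derive t 1 cos (- 1 * sin t) by apply: is_derive_eq; ring.
have pc : cos (pi *+ 2) = cos (0 : R) by rewrite cos2pi cos0.
have ps : sin (pi *+ 2) = sin (0 : R) by rewrite sin2pi sin0.
rewrite (first_coef (@is_derive_sin R) dc ps pc r1) turn_int_sin2.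
rewrite (eq_turn_int (g := fun t => sin t * cos t)); last by move=> t; rewrite mulrC.
rewrite turn_int_sincos; ring.
Qed.

End Means.
End HarmonicMeans.


(** * Complex derivatives and real gradients *)

Section LittleO.
Context {K : numFieldType} {V W : normedModType K}.

Lemma is_diff_near (f df : V -> W) x (e : K) : is_diff x f df -> 0 < e ->
  \forall h \near (0 : V), `|f (h + x) - f x - df h| <= e * `|h|.
Proof.
move=> [dfx <-] e0; have [_] := (diff_locallyP _ _).1 dfx.
move=> /eqaddoP /(_ e e0); apply: filterS => h /=.
by rewrite !fctE /= opprD addrA.
Qed.

Lemma near_is_diff (f : V -> W) (df : {linear V -> W}) x : continuous df ->
  (forall e : K, 0 < e ->
    \forall h \near (0 : V), `|f (h + x) - f x - df h| <= e * `|h|) ->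
  is_diff x f df.
Proof.
move=> cdf fo.
have E : f \o shift x = cst (f x) + df +o_ (0 : V) id.
  apply/eqaddoP => e e0; apply: filterS (fo e e0) => h /=.
  by rewrite !fctE /= opprD addrA.
have D := diff_unique cdf E.
split=> //; apply/diff_locallyP; rewrite D; split => //.
Qed.

End LittleO.

Section ComplexDerivative.
Context {R : realType}.
Local Notation C := R[i].
Local Notation Re := complex.Re.
Local Notation Im := complex.Im.
Implicit Types (f g : C -> C) (z d : C).

Definition cderiv f z d := is_derive (z : C^o) (1 : C^o) (f : C^o -> C^o) d.

Lemma cderiv_diff f z d : cderiv f z d <->
  is_diff (z : C^o) (f : C^o -> C^o) (fun h => h * d).
Proof.
split=> [fd|fd].
  have df : derivable (f : C^o -> C^o) (z : C^o) 1 by case: fd.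
  split; first exact/derivable1_diffP.
  by rewrite deriv1E// derive1E (@derive_val _ _ _ _ _ _ _ fd).
split; first by apply: diff_derivable; case: fd.
rewrite deriveE; last by case: fd.
by case: fd => _ ->; rewrite mul1r.
Qed.

Lemma cderiv_uniq f z d d' : cderiv f z d -> cderiv f z d' -> d = d'.
Proof. by move=> [_ <-] [_ <-]. Qed.

Lemma cderiv_derivable f z d : cderiv f z d ->
  derivable (f : C^o -> C^o) (z : C^o) 1.
Proof. by case. Qed.

Lemma cderiv_continuous f z d : cderiv f z d -> {for z, continuous (f : C^o -> C^o)}.
Proof. by move=> /cderiv_diff[df _]; exact: differentiable_continuous. Qed.

Lemma cderiv_cst (k : C) z : cderiv (fun=> k) z 0.
Proof. exact: is_derive_cst. Qed.

Lemma cderiv_id z : cderiv id z 1.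
Proof. exact: is_derive_id. Qed.

Lemma cderivD f g z d d' : cderiv f z d -> cderiv g z d' ->
  cderiv (fun w => f w + g w) z (d + d').
Proof. exact: is_deriveD. Qed.

Lemma cderivM f g z d d' : cderiv f z d -> cderiv g z d' ->
  cderiv (fun w => f w * g w) z (f z * d' + g z * d).
Proof. exact: is_deriveM. Qed.

Lemma cderivV f z d : f z != 0 -> cderiv f z d ->
  cderiv (fun w => (f w)^-1) z (- (f z) ^- 2 * d).
Proof.
move=> fz fd; have df := cderiv_derivable fd; split; first exact: derivableV.
by rewrite deriveV//; congr (_ *: _); case: fd.
Qed.

Lemma cderiv_comp f g z d d' : cderiv f z d -> cderiv g (f z) d' ->
  cderiv (fun w => g (f w)) z (d' * d).
Proof.
move=> /cderiv_diff df /cderiv_diff dg; apply/cderiv_diff.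
have := is_diff_comp df dg; congr is_diff_def.
by apply/funext => h /=; rewrite -mulrA (mulrC d).
Qed.

Lemma cderiv_eq f z d d' : cderiv f z d -> d = d' -> cderiv f z d'.
Proof. by move=> fd <-. Qed.

Lemma near_cderiv f g z d : (\forall w \near (z : C^o), f w = g w) ->
  cderiv f z d -> cderiv g z d.
Proof. by move=> fg; apply: (@near_eq_is_derive _ C^o C^o f g). Qed.


Lemma near_cderivI (f : C -> C) z d :
  (forall e : C, 0 < e ->
    \forall h \near (0 : C^o), `|f (h + z) - f z - h * d| <= e * `|h|) ->
  cderiv f z d.
Proof.
move=> fo; apply/cderiv_diff.
pose lf : C^o -> C^o := fun h => h * d.
have llin : linear lf by move=> k x y; rewrite /lf mulrDl /GRing.scale/= mulrA.
pose lM := GRing.isLinear.Build _ _ _ _ _ llin.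
pose lL : {linear C^o -> C^o} := HB.pack lf lM.
apply: (@near_is_diff _ C^o C^o f lL) => //.
exact: (@scalel_continuous _ C^o).
Qed.

Lemma cderiv_small_o (f : C -> C) z d (e : C) : cderiv f z d -> 0 < e ->
  \forall h \near (0 : C^o), `|f (h + z) - f z - h * d| <= e * `|h|.
Proof. by move=> /cderiv_diff fd e0; exact: (is_diff_near fd e0). Qed.

Lemma pos_complexE (e : C) : 0 < e -> e = (Re e)%:C%C /\ 0 < Re e.
Proof.
rewrite ltcE /= => /andP[/eqP ei er]; split=> //.
by case: e ei {er} => x y /= ->.
Qed.

Definition cplx (p : R * R) : C := Complex p.1 p.2.

Lemma cplxK p : pair_of_complex (cplx p) = p. Proof. by case: p. Qed.
Lemma pair_of_complexK z : cplx (pair_of_complex z) = z. Proof. by case: z. Qed.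

Definition lin2 (W : normedModType R) (a b : W) (h : R * R) : W :=
  h.1 *: a + h.2 *: b.

Lemma lin2_is_linear (W : normedModType R) (a b : W) : linear (lin2 a b).
Proof.
move=> k x y; rewrite /lin2 /= !scalerDl scalerDr !scalerA.
by rewrite addrACA.
Qed.

HB.instance Definition _ (W : normedModType R) (a b : W) :=
  GRing.isLinear.Build R (R * R)%type W *:%R (lin2 a b) (lin2_is_linear a b).

Lemma lin2_continuous (W : normedModType R) (a b : W) : continuous (lin2 a b).
Proof.
move=> p; apply: cvgD.
  exact: (continuous_comp (@fst_continuous R p) (@scalel_continuous _ _ a p.1)).
exact: (continuous_comp (@snd_continuous R p) (@scalel_continuous _ _ b p.2)).
Qed.


Lemma norm_Re_le (w : C) : `|Re w|%:C%C <= `|w|.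
Proof.
rewrite normc_def lecR -[leLHS]sqrtr_sqr; apply: ler_wsqrtr.
by rewrite lerDl sqr_ge0.
Qed.

Lemma norm_Im_le (w : C) : `|Im w|%:C%C <= `|w|.
Proof.
rewrite normc_def lecR -[leLHS]sqrtr_sqr; apply: ler_wsqrtr.
by rewrite lerDr sqr_ge0.
Qed.

Lemma le_norm_ReIm (w : C) : `|w| <= (`|Re w| + `|Im w|)%:C%C.
Proof.
have s0 : 0 <= `|Re w| + `|Im w| by rewrite addr_ge0.
rewrite normc_def lecR -[leRHS]ger0_norm// -sqrtr_sqr; apply: ler_wsqrtr.
rewrite sqrrD !real_normK ?num_real// lerD2r lerDl.
by rewrite mulrn_wge0// mulr_ge0.
Qed.

Lemma norm_pair_le (p : R * R) : `|p|%:C%C <= `|cplx p|.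
Proof.
rewrite prod_normE /=; case: leP => _.
  exact: (norm_Im_le (cplx p)).
exact: (norm_Re_le (cplx p)).
Qed.

Lemma le_norm_pair (p : R * R) : `|cplx p| <= (2 * `|p|)%:C%C.
Proof.
apply: (le_trans (le_norm_ReIm _)); rewrite lecR /= mulr_natl mulr2n prod_normE /=.
by apply: lerD; rewrite le_max lexx ?orbT.
Qed.

Lemma near0_cplx (P : C -> Prop) : (\forall h \near (0 : C^o), P h) ->
  \forall h \near (0 : R * R), P (cplx h).
Proof.
move=> /nbhs_ballP[e /= e0 eP].
have [eR Re0] := pos_complexE e0.
apply/nbhs_ballP; exists (Re e / 2) => /=; first by rewrite divr_gt0.
move=> h; rewrite -ball_normE /= sub0r normrN => hlt; apply: eP.
rewrite -ball_normE /= sub0r normrN; apply: (le_lt_trans (le_norm_pair h)).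
rewrite eR ltcR; lra.
Qed.

Lemma near0_pair (P : R * R -> Prop) : (\forall h \near (0 : R * R), P h) ->
  \forall h \near (0 : C^o), P (pair_of_complex h).
Proof.
move=> /nbhs_ballP[e /= e0 eP].
apply/nbhs_ballP; exists (e%:C%C) => /=; first by rewrite ltcR.
move=> h; rewrite -ball_normE /= sub0r normrN => hlt; apply: eP.
rewrite -ball_normE /= sub0r normrN -ltcR; apply: le_lt_trans hlt.
by have := norm_pair_le (pair_of_complex h); rewrite pair_of_complexK.
Qed.

(** The norm of [R * R] is the maximum norm, which is equivalent to the modulus;
    this is what allows one to exchange small remainders. *)
Lemma cderiv_Re_diff f (p : R * R) d : cderiv f (cplx p) d ->
  is_diff p (fun q => Re (f (cplx q))) (lin2 (Re d) (- Im d)).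
Proof.
move=> /cderiv_diff df; apply: near_is_diff; first exact: lin2_continuous.
move=> e e0.
have e20 : 0 < (e / 2)%:C%C by rewrite ltcR divr_gt0.
have := near0_cplx (is_diff_near df e20); apply: filterS => h /= H.
rewrite -lecR.
have := le_trans (norm_Re_le _) H.
have := le_norm_pair h; rewrite -(ler_pM2l e20) => H2 H1.
have := le_trans H1 H2.
rewrite -rmorphM /= mulrA divfK ?pnatr_eq0//; apply: le_trans.
rewrite lecR le_eqVlt; apply/orP; left; apply/eqP; congr `|_|.
have -> : cplx (h + p) = cplx h + cplx p by [].
case: (f _) => a b; case: (f _) => a' b'; case: d {df H H1 H2} => u v.
by rewrite /lin2 /GRing.scale /=; ring.
Qed.

Lemma cderiv_Im_diff f (p : R * R) d : cderiv f (cplx p) d ->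
  is_diff p (fun q => Im (f (cplx q))) (lin2 (Im d) (Re d)).
Proof.
move=> fd; have := cderiv_Re_diff (cderivM (cderiv_cst (- 'i%C) (cplx p)) fd).
have -> : (fun q => Re (- 'i%C * f (cplx q))) = (fun q => Im (f (cplx q))).
  by apply/funext => q; case: (f _) => a b /=; ring.
rewrite mulr0 addr0.
have -> : Re (- 'i%C * d) = Im d by case: d {fd} => u v /=; ring.
by have -> : - Im (- 'i%C * d) = Re d by case: d {fd} => u v /=; ring.
Qed.

(** The converse direction: real differentiability together with the
    Cauchy-Riemann equations gives a complex derivative. *)
Lemma grad_cderiv f (p : R * R) (a b : R) :
  is_diff p (fun q => Re (f (cplx q))) (lin2 a (- b)) ->
  is_diff p (fun q => Im (f (cplx q))) (lin2 b a) ->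
  cderiv f (cplx p) (Complex a b).
Proof.
move=> df1 df2; apply: near_cderivI => e e0.
have [eR Re0] := pos_complexE e0.
have e20 : 0 < Re e / 2 by rewrite divr_gt0.
have := near0_pair (is_diff_near df1 e20).
have := near0_pair (is_diff_near df2 e20).
apply: filterS2 => h /= H2 H1.
apply: (le_trans (le_norm_ReIm _)).
apply: (@le_trans _ _ ((Re e * `|pair_of_complex h|)%:C%C)); last first.
  rewrite rmorphM/= -eR ler_pM2l//.
  by have := norm_pair_le (pair_of_complex h); rewrite pair_of_complexK.
rewrite lecR (_ : Re e * _ = Re e / 2 * `|pair_of_complex h| +
   Re e / 2 * `|pair_of_complex h|); last by field.
have E : h + cplx p = cplx (pair_of_complex h + p) by case: h {H1 H2}.
rewrite E.
apply: lerD.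
  apply: le_trans H1; rewrite le_eqVlt; apply/orP; left; apply/eqP; congr `|_|.
  case: (f _) => x y; case: (f _) => x' y'; case: h {E H2} => u v.
  by rewrite /lin2 /GRing.scale /=; ring.
apply: le_trans H2; rewrite le_eqVlt; apply/orP; left; apply/eqP; congr `|_|.
case: (f _) => x y; case: (f _) => x' y'; case: h {E H1} => u v.
by rewrite /lin2 /GRing.scale /=; ring.
Qed.

End ComplexDerivative.


(** * Inner products, and harmonic maps with explicit partial derivatives *)

Section InnerProduct.
Context {R : realType} {H : normedModType R} (dot : {dot H for idfun}).
Hypothesis norm_dot : forall x : H, `|x| ^+ 2 = dot x x.

Lemma dotC x y : dot x y = dot y x.
Proof. by rewrite hermC expr0 mul1r. Qed.

Lemma dotDl x y z : dot (x + y) z = dot x z + dot y z.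
Proof. exact: linearDl. Qed.

Lemma dotZl k x z : dot (k *: x) z = k * dot x z.
Proof. exact: linearZl_LR. Qed.

Lemma dotDr x y z : dot z (x + y) = dot z x + dot z y.
Proof. by rewrite dotC dotDl !(dotC z). Qed.

Lemma dotZr k x z : dot z (k *: x) = k * dot z x.
Proof. by rewrite dotC dotZl dotC. Qed.

Lemma dotNl x z : dot (- x) z = - dot x z.
Proof. by rewrite -scaleN1r dotZl mulN1r. Qed.

Lemma dotNr x z : dot z (- x) = - dot z x.
Proof. by rewrite dotC dotNl dotC. Qed.

Lemma dot0l z : dot 0 z = 0.
Proof. by rewrite -(scale0r (0 : H)) dotZl mul0r. Qed.

Definition dotE := (dotDl, dotDr, dotNl, dotNr, dotZl, dotZr).

Lemma dotBB x y : dot (x - y) (x - y) = dot x x - 2 * dot x y + dot y y.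
Proof. by rewrite !dotE (dotC y x); ring. Qed.

Lemma dot_ge0 x : 0 <= dot x x.
Proof. by rewrite -norm_dot sqr_ge0. Qed.

Lemma dot_sqr_le x y : dot x y ^+ 2 <= dot x x * dot y y.
Proof.
have [->|y0] := eqVneq y 0.
  by rewrite (dotC x) !dot0l expr0n mulr0.
have yy : 0 < dot y y by rewrite -norm_dot exprn_gt0// normr_gt0.
have h := dot_ge0 (dot y y *: x - dot x y *: y).
rewrite -subr_ge0 -(pmulr_rge0 _ yy); move: h.
rewrite !dotE (dotC y x); congr (0 <= _); ring.
Qed.

Lemma dot_norm_le x y : `|dot x y| <= `|x| * `|y|.
Proof.
rewrite -(@ler_pXn2r _ 2)// ?nnegrE ?mulr_ge0//.
by rewrite real_normK ?num_real// exprMn !norm_dot dot_sqr_le.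
Qed.

Lemma dotl_is_linear e : linear (fun x => dot x e).
Proof. by move=> k x y; rewrite dotDl dotZl. Qed.

Lemma dotl_is_diff e x : is_diff x (fun y => dot y e) (fun h => dot h e).
Proof.
pose lM := GRing.isLinear.Build _ _ _ _ _ (dotl_is_linear e).
pose lL : {linear H -> R} := HB.pack (fun x : H => dot x e) lM.
have cL : continuous lL.
  apply: bounded_linear_continuous; apply/linear_boundedP.
  exists `|e|; split; first exact: num_real.
  move=> M eM y /=; apply: (le_trans (dot_norm_le _ _)).
  by rewrite mulrC ler_wpM2r// ltW.
apply: (@near_is_diff _ _ _ _ lL) => // d d0; apply: nearW => h.
by rewrite /= dotDl addrK subrr normr0 mulr_ge0// ltW.
Qed.

Lemma has_grad_dot U (F Fx Fy : R * R -> H) e : has_grad U F Fx Fy ->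
  has_grad U (fun z => dot (F z) e) (fun z => dot (Fx z) e)
    (fun z => dot (Fy z) e).
Proof.
move=> gF z Uz; have := is_diff_comp (gF z Uz) (dotl_is_diff e (F z)).
by congr is_diff_def; apply/funext => h /=; rewrite dotDl !dotZl.
Qed.

Lemma second_grad_dot U (F Fx Fy Fxx Fxy Fyx Fyy : R * R -> H) e :
  second_grad U F Fx Fy Fxx Fxy Fyx Fyy ->
  second_grad U (fun z => dot (F z) e) (fun z => dot (Fx z) e)
    (fun z => dot (Fy z) e) (fun z => dot (Fxx z) e) (fun z => dot (Fxy z) e)
    (fun z => dot (Fyx z) e) (fun z => dot (Fyy z) e).
Proof.
have cdot (G : R * R -> H) z : {for z, continuous G} ->
    {for z, continuous (fun w => dot (G w) e)}.
  move=> cG; have [dd _] := dotl_is_diff e (G z).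
  exact: (continuous_comp cG (differentiable_continuous dd)).
case=> gF gFx gFy cxx cxy cyx cyy.
by split; do ?[exact: has_grad_dot]; move=> z Uz; apply: cdot; auto.
Qed.

End InnerProduct.

Section HarmonicSecondGrad.
Context {R : realType} {H : normedModType R}.
Implicit Types (F : R * R -> H) (U : set (R * R)).

Lemma open_unit_disk : open (@unit_disk R).
Proof.
have -> : @unit_disk R = (fun z => z.1 * z.1 + z.2 * z.2) @^-1` [set x | x < 1].
  by apply/seteqP; split => z; rewrite unit_diskE !expr2.
apply: open_comp; last exact: open_lt.
move=> z _; apply: cvgD; apply: cvgM; try exact: fst_continuous;
  exact: snd_continuous.
Qed.

Lemma harmonic_second_grad U F : harmonic_on U F ->
  exists Fx Fy Fxx Fxy Fyx Fyy, second_grad U F Fx Fy Fxx Fxy Fyx Fyy /\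
    forall z, U z -> Fxx z + Fyy z = 0.
Proof.
have gradE (G : R * R -> H) : C1_on U G ->
    has_grad U G ('D_(1, 0) G) ('D_(0, 1) G).
  move=> G1 z Uz; have [dG _] := G1 z Uz; split=> //; apply/funext => h.
  rewrite !deriveE//.
  have -> : 'd G z h = 'd G z (h.1 *: (1, 0) + h.2 *: (0, 1)).
    congr ('d G z _); case: h => a b /=.
    congr (_, _).
      by rewrite -[RHS]/(a * 1 + b * 0) mulr1 mulr0 addr0.
    by rewrite -[RHS]/(a * 0 + b * 1) mulr1 mulr0 add0r.
  by rewrite linearD !linearZ.
move=> [[F1 F2] lap].
exists ('D_(1, 0) F), ('D_(0, 1) F), ('D_(1, 0) ('D_(1, 0) F)),
  ('D_(0, 1) ('D_(1, 0) F)), ('D_(1, 0) ('D_(0, 1) F)),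
  ('D_(0, 1) ('D_(0, 1) F)); split=> //.
have cD u v z : U z -> {for z, continuous ('D_v ('D_u F))}.
  by move=> Uz; have [_ cG] := F2 u z Uz; exact: cG.
by split; do ?[exact: gradE]; move=> z Uz; exact: cD.
Qed.

Lemma near_eq_is_diff (f g df : R * R -> H) z :
  (\forall w \near z, f w = g w) -> is_diff z f df -> is_diff z g df.
Proof.
move=> fg [dff dfE].
have fgz : f z = g z by exact: nbhs_singleton fg.
have {}fg : \forall h \near 0, f (h + z) = g (h + z).
  have := fg; rewrite (near_shift 0) /=; apply: filterS => h /=.
  by rewrite subr0.
suff [dg dgE] : is_diff z g ('d f z) by split; [exact: dg|rewrite dgE; exact: dfE].
apply: near_is_diff; first exact: diff_continuous.
move=> e e0; have H1 := is_diff_near (differentiableP dff) e0.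
by move: fg H1; apply: filterS2 => h <-; rewrite fgz.
Qed.

(** The directional derivatives agree with the given combinations of partial
    derivatives only on [U]; since [U] is open this suffices to differentiate
    them again. *)
Lemma second_grad_harmonic U F Fx Fy Fxx Fxy Fyx Fyy : open U ->
  second_grad U F Fx Fy Fxx Fxy Fyx Fyy ->
  (forall z, U z -> Fxx z + Fyy z = 0) -> harmonic_on U F.
Proof.
move=> oU [gF gFx gFy cxx cxy cyx cyy] lap.
have nearU z : U z -> \forall w \near z, U w by move=> Uz; exact: open_nbhs_nbhs.
have cont_near (f g : R * R -> H) z : {for z, continuous g} ->
    (forall w, U w -> g w = f w) -> U z -> {for z, continuous f}.
  move=> cg gf Uz; suff : f w @[w --> z] --> g z by rewrite (gf _ Uz).
  apply: cvg_trans cg; apply: near_eq_cvg.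
  by apply: filterS (nearU z Uz).
have DE (G Gx Gy : R * R -> H) v z : has_grad U G Gx Gy -> U z ->
    'D_v G z = v.1 *: Gx z + v.2 *: Gy z.
  by move=> gG Uz; have [dG E] := gG z Uz; rewrite deriveE// E.
have cont_comb (Gx Gy : R * R -> H) (v : R * R) z :
    {for z, continuous Gx} -> {for z, continuous Gy} ->
    {for z, continuous (fun w => v.1 *: Gx w + v.2 *: Gy w)}.
  by move=> cx cy; apply: cvgD; apply: cvgZ => //; exact: cvg_cst.
have gD v : has_grad U ('D_v F) (fun z => v.1 *: Fxx z + v.2 *: Fyx z)
    (fun z => v.1 *: Fxy z + v.2 *: Fyy z).
  move=> z Uz; apply: (@near_eq_is_diff (fun w => v.1 *: Fx w + v.2 *: Fy w)).
    by apply: filterS (nearU z Uz) => w Uw; rewrite (DE _ _ _ _ _ gF).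
  have d1 := is_diffZ v.1 (gFx z Uz); have d2 := is_diffZ v.2 (gFy z Uz).
  have := is_diffD d1 d2; congr is_diff_def.
  apply/funext => h; rewrite !fctE !scalerDr !scalerA addrACA.
  by congr (_ + _); congr (_ + _); rewrite mulrC.
split.
  split.
    move=> z Uz; split; first by have [] := gF z Uz.
    move=> v; apply: (cont_near _ (fun w => v.1 *: Fx w + v.2 *: Fy w)) => //.
      apply: cont_comb.
        by have [d _] := gFx z Uz; exact: differentiable_continuous.
      by have [d _] := gFy z Uz; exact: differentiable_continuous.
    by move=> w Uw; rewrite (DE _ _ _ _ _ gF).
  move=> v z Uz; split; first by have [] := gD v z Uz.
  move=> w; apply: (cont_near _ (fun z => w.1 *: (v.1 *: Fxx z + v.2 *: Fyx z) +
     w.2 *: (v.1 *: Fxy z + v.2 *: Fyy z))) => //.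
    by apply: (cont_comb _ _); apply: (cont_comb _ _); auto.
  by move=> y Uy; rewrite (DE _ _ _ _ _ (gD v)).
move=> z Uz; rewrite /laplacian !(DE _ _ _ _ _ (gD _))//=.
by rewrite !scale1r !scale0r !add0r !addr0 lap.
Qed.

End HarmonicSecondGrad.


(** * Holomorphic functions as harmonic maps into a plane *)

Section HolomorphicMaps.
Context {R : realType} {H : normedModType R}.
Local Notation C := R[i].
Local Notation Re := complex.Re.
Local Notation Im := complex.Im.
Implicit Types (m : C -> C).

(** Two complex derivatives, the second one continuous: exactly what makes the
    real and imaginary parts of class C2. With the derivatives as data,
    those of compositions and inverses are given by explicit formulas. *)
Definition hol2 (D : set C) m m1 m2 := forall z, D z ->
  [/\ cderiv m z (m1 z), cderiv m1 z (m2 z)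
    & {for z, continuous (m2 : C^o -> C^o)}].

(** The real-linear map sending [1] to [e1] and [i] to [e2]. *)
Definition place (e1 e2 : H) (w : C) : H := Re w *: e1 + Im w *: e2.

Lemma placeN e1 e2 w : place e1 e2 (- w) = - place e1 e2 w.
Proof. by case: w => a b; rewrite /place /= !scaleNr opprD. Qed.

Lemma mulic (a b : R) : 'i%C * Complex a b = Complex (- b) a.
Proof. by apply/eqP; rewrite eq_complex /= !mul0r !mul1r !add0r !eqxx. Qed.

Lemma place_is_diff e1 e2 m (p : R * R) d : cderiv m (cplx p) d ->
  is_diff p (fun q => place e1 e2 (m (cplx q)))
    (fun h => h.1 *: place e1 e2 d + h.2 *: place e1 e2 ('i%C * d)).
Proof.
move=> md; have dRe := cderiv_Re_diff md; have dIm := cderiv_Im_diff md.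
have d1 := is_diff_comp dRe (is_diff_scalel (Re (m (cplx p))) e1).
have d2 := is_diff_comp dIm (is_diff_scalel (Im (m (cplx p))) e2).
have := is_diffD d1 d2; congr is_diff_def.
apply/funext => h; rewrite !fctE /=; case: d {md dRe dIm d1 d2} => a b.
rewrite mulic /lin2 /place /= !scalerDr !scalerA !scalerDl addrACA.
by rewrite /GRing.scale/=.
Qed.

Lemma Re_continuous : continuous (@complex.Re R : C^o -> R).
Proof.
move=> z; apply/(@cvgrPdist_le _ _ _ (nbhs (z : C^o)) (nbhs_filter (z : C^o))) => e e0.
apply/nbhs_ballP; exists (e%:C%C) => /=; first by rewrite ltcR.
move=> w; rewrite -ball_normE /= => /ltW h; rewrite -lecR.
apply: le_trans h; have := norm_Re_le (z - w).
by case: z w => a b [a' b'].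
Qed.

Lemma Im_continuous : continuous (@complex.Im R : C^o -> R).
Proof.
move=> z; apply/(@cvgrPdist_le _ _ _ (nbhs (z : C^o)) (nbhs_filter (z : C^o))) => e e0.
apply/nbhs_ballP; exists (e%:C%C) => /=; first by rewrite ltcR.
move=> w; rewrite -ball_normE /= => /ltW h; rewrite -lecR.
apply: le_trans h; have := norm_Im_le (z - w).
by case: z w => a b [a' b'].
Qed.

Lemma cplx_continuous : continuous (cplx : R * R -> C^o).
Proof.
move=> p; apply/cvgrPdist_le => e e0.
have [eR Re0] := pos_complexE e0.
apply/(@nbhs_ballP R (R * R)%type); exists (Re e / 2) => /=; first by rewrite divr_gt0.
move=> q; rewrite -ball_normE /= => h; rewrite eR.
have -> : cplx p - cplx q = cplx (p - q) by [].
apply: (le_trans (le_norm_pair _)); rewrite lecR; lra.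
Qed.

Lemma place_continuous e1 e2 m (p : R * R) :
  {for cplx p, continuous (m : C^o -> C^o)} ->
  {for p, continuous (fun q => place e1 e2 (m (cplx q)))}.
Proof.
move=> cm.
have cmp : {for p, continuous ((m : C^o -> C^o) \o (cplx : R * R -> C^o))}.
  exact: (continuous_comp (@cplx_continuous p) cm).
apply: cvgD; apply: cvgZr_tmp.
  exact: (continuous_comp cmp (@Re_continuous _)).
exact: (continuous_comp cmp (@Im_continuous _)).
Qed.

(** The partial derivative in the second variable is [i] times the complex
    derivative, so the second one in that direction is [- m2] and the Laplacian
    cancels. *)
Lemma hol2_second_grad (D : set C) m m1 m2 (c : H) e1 e2 : hol2 D m m1 m2 ->
  second_grad (cplx @^-1` D) (fun p => c + place e1 e2 (m (cplx p)))
    (fun p => place e1 e2 (m1 (cplx p)))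
    (fun p => place e1 e2 ('i%C * m1 (cplx p)))
    (fun p => place e1 e2 (m2 (cplx p)))
    (fun p => place e1 e2 ('i%C * m2 (cplx p)))
    (fun p => place e1 e2 ('i%C * m2 (cplx p)))
    (fun p => - place e1 e2 (m2 (cplx p))).
Proof.
move=> hm.
have im2 z : D z -> cderiv (fun w => 'i%C * m1 w) z ('i%C * m2 z).
  move=> Dz; have [_ d _] := hm z Dz.
  by apply: cderiv_eq (cderivM (cderiv_cst _ _) d) _; rewrite mulr0 addr0.
have cim2 z : {for z, continuous (m2 : C^o -> C^o)} ->
    {for z, continuous ((fun w => 'i%C * m2 w) : C^o -> C^o)}.
  move=> cm; have ci := @cst_continuous C^o C^o 'i%C z.
  exact: (@continuousM C C^o (fun=> 'i%C) m2 z ci cm).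
split.
- move=> p Dp; have [d _ _] := hm _ Dp.
  have := is_diffD (is_diff_cst c p) (place_is_diff e1 e2 d).
  by congr is_diff_def; apply/funext => h; rewrite !fctE add0r.
- by move=> p Dp; have [_ d _] := hm _ Dp; exact: place_is_diff.
- move=> p Dp; have := place_is_diff e1 e2 (im2 _ Dp).
  congr is_diff_def; apply/funext => h.
  by rewrite mulrA -expr2 sqr_i mulN1r placeN.
- by move=> p Dp; have [_ _ ?] := hm _ Dp; exact: place_continuous.
- move=> p Dp; have [_ _ cm] := hm _ Dp.
  exact: (@place_continuous e1 e2 (fun w => 'i%C * m2 w) p (cim2 _ cm)).
- move=> p Dp; have [_ _ cm] := hm _ Dp.
  exact: (@place_continuous e1 e2 (fun w => 'i%C * m2 w) p (cim2 _ cm)).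
- by move=> p Dp; have [_ _ ?] := hm _ Dp; apply: cvgN; exact: place_continuous.
Qed.

End HolomorphicMaps.

(** * Moebius maps of the unit disk *)

Section Mobius.
Context {R : realType}.
Local Notation C := R[i].
Implicit Types (a z w : C).

Lemma ltr_norm1 z : (`|z| < 1) = (z * (z^*)%C < 1).
Proof. by rewrite -sqr_normc expr_lt1. Qed.

Lemma unit_disk_cplx (p : R * R) : unit_disk p <-> `|cplx p| < 1.
Proof. by rewrite /unit_disk /eucl_norm normc_def /= ltcR. Qed.

Lemma unit_disk_pair z : unit_disk (pair_of_complex z) <-> `|z| < 1.
Proof. by rewrite unit_disk_cplx pair_of_complexK. Qed.

Definition mob a z := (z + a) / (1 + (a^*)%C * z).
(** The first and second complex derivatives of [mob a]. *)
Definition mob1 a z := (1 - a * (a^*)%C) / (1 + (a^*)%C * z) ^+ 2.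
Definition mob2 a z := - (2 * (a^*)%C) * (1 - a * (a^*)%C) / (1 + (a^*)%C * z) ^+ 3.

Lemma mob_den_neq0 a z : `|a| < 1 -> `|z| <= 1 -> 1 + (a^*)%C * z != 0.
Proof.
move=> a1 z1; rewrite addrC addr_eq0; apply/eqP => E.
have : `|(a^*)%C * z| < 1.
  by rewrite normrM normcJ; apply: (le_lt_trans _ a1); rewrite ler_piMr.
by rewrite E normrN1 ltxx.
Qed.

Lemma conjcD z w : ((z + w)^*)%C = (z^*)%C + (w^*)%C.
Proof. exact: rmorphD. Qed.
Lemma conjcM z w : ((z * w)^*)%C = (z^*)%C * (w^*)%C.
Proof. exact: rmorphM. Qed.
Lemma conjcV z : ((z^-1)^*)%C = (z^*)%C^-1.
Proof. exact: fmorphV. Qed.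
Lemma conjcN z : ((- z)^*)%C = - (z^*)%C.
Proof. exact: rmorphN. Qed.

(** The classical identity behind the invariance of the disk and of the circle. *)
Lemma mob_norm a z : `|a| < 1 -> `|z| <= 1 ->
  1 - `|mob a z| ^+ 2 =
  (1 - `|a| ^+ 2) * (1 - `|z| ^+ 2) / `|1 + (a^*)%C * z| ^+ 2.
Proof.
move=> a1 z1; have d0 := mob_den_neq0 a1 z1.
have d0' : 1 + a * (z^*)%C != 0.
  have : ((1 + (a^*)%C * z)^*)%C != 0 by rewrite conjc_eq0.
  by rewrite conjcD conjcM conjcK conjc1.
rewrite !sqr_normc /mob !conjcM conjcV !conjcD !conjcM conjcK conjc1.
by field; rewrite d0 d0'.
Qed.

Lemma mob_lt1 a z : `|a| < 1 -> `|z| < 1 -> `|mob a z| < 1.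
Proof.
move=> a1 z1; have d0 := mob_den_neq0 a1 (ltW z1).
have sq x : (`|x| < 1 :> C) = (0 < 1 - `|x| ^+ 2).
  by rewrite subr_gt0 expr_lt1.
rewrite sq mob_norm//; last exact: ltW.
apply: divr_gt0; last by rewrite exprn_gt0// normr_gt0.
by apply: mulr_gt0; rewrite -sq.
Qed.

Lemma mob_eq1 a z : `|a| < 1 -> `|z| = 1 -> `|mob a z| = 1.
Proof.
move=> a1 z1; have := @mob_norm a z a1; rewrite z1 => /(_ (lexx _)).
rewrite expr1n subrr mulr0 mul0r => /eqP; rewrite subr_eq0 eq_sym.
by rewrite sqrp_eq1// => /eqP.
Qed.

Lemma mobK a z : `|a| < 1 -> `|z| < 1 -> mob (- a) (mob a z) = z.
Proof.
move=> a1 z1; have d0 := mob_den_neq0 a1 (ltW z1).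
have aa : 1 - a * (a^*)%C != 0.
  by rewrite subr_eq0 eq_sym; apply/eqP => E; move: a1; rewrite ltr_norm1 E ltxx.
rewrite /mob conjcN; field; rewrite d0 /=.
have -> : 1 + (a^*)%C * z + - (a^*)%C * (z + a) = 1 - a * (a^*)%C by ring.
by rewrite aa.
Qed.

Lemma mob_hol2 a : `|a| < 1 -> hol2 [set z | `|z| < 1] (mob a) (mob1 a) (mob2 a).
Proof.
move=> a1 z /= z1; have d0 := mob_den_neq0 a1 (ltW z1).
have dden : cderiv (fun w => 1 + (a^*)%C * w) z ((a^*)%C).
  have dM := cderivM (cderiv_cst (a^*)%C z) (cderiv_id z).
  apply: cderiv_eq (cderivD (cderiv_cst 1 z) dM) _.
  by rewrite mulr1 mulr0 addr0 add0r.
have dnum : cderiv (fun w => w + a) z 1.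
  by apply: cderiv_eq (cderivD (cderiv_id z) (cderiv_cst a z)) _; rewrite addr0.
have dexp n : cderiv (fun w => (1 + (a^*)%C * w) ^+ n.+1) z
    (n.+1%:R * (1 + (a^*)%C * z) ^+ n * (a^*)%C).
  elim: n => [|n IH]; first by apply: cderiv_eq dden _; rewrite expr0; ring.
  have := cderivM dden IH.
  under eq_fun do rewrite -exprS.
  by move=> h; apply: cderiv_eq h _; rewrite -!natr1 !exprS; ring.
split.
- apply: cderiv_eq (cderivM dnum (cderivV (f := fun w => 1 + (a^*)%C * w) d0 dden)) _.
  by rewrite /mob1; field.
- have d2 : (1 + (a^*)%C * z) ^+ 2 != 0 by rewrite expf_neq0.
  have dV := cderivV (f := fun w => (1 + (a^*)%C * w) ^+ 2) d2 (dexp 1%N).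
  apply: cderiv_eq (cderivM (cderiv_cst _ z) dV) _.
  by rewrite /mob2; field.
- have d3 : (1 + (a^*)%C * z) ^+ 3 != 0 by rewrite expf_neq0.
  have dV := cderivV (f := fun w => (1 + (a^*)%C * w) ^+ 3) d3 (dexp 2%N).
  exact: (cderiv_continuous (cderivM (cderiv_cst _ z) dV)).
Qed.

End Mobius.


(** * Differences and squares of functions of class C2, polar coordinates *)

Section SecondGradOps.
Context {R : realType}.

Lemma second_gradB (H : normedModType R) U
    (f fx fy fxx fxy fyx fyy g gx gy gxx gxy gyx gyy : R * R -> H) :
  second_grad U f fx fy fxx fxy fyx fyy ->
  second_grad U g gx gy gxx gxy gyx gyy ->
  second_grad U (f - g) (fx - gx) (fy - gy) (fxx - gxx) (fxy - gxy) (fyx - gyx)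
    (fyy - gyy).
Proof.
have gB (F Fx Fy G Gx Gy : R * R -> H) : has_grad U F Fx Fy ->
    has_grad U G Gx Gy -> has_grad U (F - G) (Fx - Gx) (Fy - Gy).
  move=> gF gG z Uz; have := is_diffB (gF z Uz) (gG z Uz).
  congr is_diff_def; apply/funext => h; rewrite !fctE !scalerBr.
  by rewrite opprD addrACA.
case=> [f1 f2 f3 f4 f5 f6 f7] [g1 g2 g3 g4 g5 g6 g7].
have cB (F G : R * R -> H) z : {for z, continuous F} -> {for z, continuous G} ->
    {for z, continuous (F - G)} by move=> cF cG; exact: cvgB.
by split; do ?[exact: gB]; move=> z Uz; apply: cB; auto.
Qed.

Lemma second_grad_sqr U (u ux uy uxx uxy uyx uyy : R * R -> R) :
  second_grad U u ux uy uxx uxy uyx uyy ->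
  second_grad U (fun z => u z * u z)
    (fun z => 2 * (u z * ux z)) (fun z => 2 * (u z * uy z))
    (fun z => 2 * (ux z * ux z + u z * uxx z))
    (fun z => 2 * (uy z * ux z + u z * uxy z))
    (fun z => 2 * (ux z * uy z + u z * uyx z))
    (fun z => 2 * (uy z * uy z + u z * uyy z)).
Proof.
case=> [g1 g2 g3 c1 c2 c3 c4].
have cu z : U z -> {for z, continuous u} := has_grad_continuous g1 (z := z).
have cux z : U z -> {for z, continuous ux} := has_grad_continuous g2 (z := z).
have cuy z : U z -> {for z, continuous uy} := has_grad_continuous g3 (z := z).
have gM (f fx fy g gx gy : R * R -> R) : has_grad U f fx fy ->
    has_grad U g gx gy -> has_grad U (fun z => f z * g z)
      (fun z => fx z * g z + f z * gx z) (fun z => fy z * g z + f z * gy z).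
  move=> gf gg z Uz; have := is_diffM (gf z Uz) (gg z Uz).
  congr is_diff_def; apply/funext => h; rewrite !fctE /GRing.scale/=; ring.
have g2M (f fx fy : R * R -> R) : has_grad U f fx fy ->
    has_grad U (fun z => 2 * f z) (fun z => 2 * fx z) (fun z => 2 * fy z).
  move=> gf z Uz; have := is_diffZ 2 (gf z Uz).
  congr is_diff_def; apply/funext => h; rewrite !fctE /GRing.scale/=; ring.
have c2M (f1 f2 f3 f4 : R * R -> R) z : {for z, continuous f1} ->
    {for z, continuous f2} -> {for z, continuous f3} -> {for z, continuous f4} ->
    {for z, continuous (fun z => 2 * (f1 z * f2 z + f3 z * f4 z))}.
  by move=> *; apply: cvgM; [exact: cvg_cst|apply: cvgD; exact: cvgM].
split.
- move=> z Uz; have := gM _ _ _ _ _ _ g1 g1 z Uz.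
  congr is_diff_def; apply/funext => h; rewrite /GRing.scale/=; ring.
- exact/g2M/gM.
- exact/g2M/gM.
- by move=> z Uz; apply: c2M; auto.
- by move=> z Uz; apply: c2M; auto.
- by move=> z Uz; apply: c2M; auto.
- by move=> z Uz; apply: c2M; auto.
Qed.

(** The angle is [acos (x / r)] in the upper half plane and its reflection in the
    lower one. *)
Lemma polar_surj (z : R * R) : unit_disk z ->
  exists r t, [/\ 0 <= r < 1, 0 <= t < pi *+ 2 & z = polar r t].
Proof.
case: z => x y; rewrite unit_diskE /= => xy1.
have s0 : 0 <= x ^+ 2 + y ^+ 2 by rewrite addr_ge0// sqr_ge0.
pose r := Num.sqrt (x ^+ 2 + y ^+ 2).
have rr : r ^+ 2 = x ^+ 2 + y ^+ 2 by rewrite sqr_sqrtr.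
have r0 : 0 <= r by exact: sqrtr_ge0.
have r1 : r < 1 by rewrite -(sqrtr1 R) ltr_sqrt.
have p0 := @pi_gt0 R.
have [re0|rn0] := eqVneq r 0.
  exists 0, 0; split; [by rewrite lexx ltr01|by rewrite lexx mulr2n; lra|].
  move: rr; rewrite re0 expr0n /= => /esym/eqP.
  rewrite paddr_eq0 ?sqr_ge0// !sqrf_eq0 => /andP[/eqP-> /eqP->].
  by rewrite /polar !mul0r.
have rp : 0 < r by rewrite lt_def rn0.
have x1 : -1 <= x / r <= 1.
  rewrite ler_pdivlMr// ler_pdivrMr// mulN1r mul1r -ler_norml.
  rewrite -(@ler_pXn2r _ 2)// ?nnegrE// real_normK ?num_real// rr.
  by rewrite lerDl sqr_ge0.
have sinE : sin (acos (x / r)) = `|y| / r.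
  rewrite sin_acos//; have -> : 1 - (x / r) ^+ 2 = (`|y| / r) ^+ 2.
    rewrite !expr_div_n real_normK ?num_real// rr; field.
    by rewrite -rr expf_neq0.
  by rewrite sqrtr_sqr ger0_norm// divr_ge0.
have a0 := acos_ge0 x1; have api := acos_lepi x1.
have cosE : cos (acos (x / r)) = x / r by rewrite acosK// in_itv.
have [y0|y0] := leP 0 y.
  exists r, (acos (x / r)); split; [by rewrite r0 r1|by rewrite a0 mulr2n; lra|].
  rewrite /polar cosE sinE ger0_norm//.
  by congr (_, _); rewrite mulrC divfK.
exists r, (pi *+ 2 - acos (x / r)); rewrite r0 r1.
have as0 : 0 < acos (x / r).
  rewrite lt_def a0 andbT; apply/eqP => E.
  move: sinE; rewrite E sin0 => /esym/eqP.
  rewrite mulf_eq0 invr_eq0 (negbTE rn0) orbF normr_eq0 => /eqP yE.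
  by rewrite yE ltxx in y0.
split; [by []|by rewrite mulr2n; lra|].
rewrite addrC /polar cosD2pi sinD2pi cosN sinN cosE sinE ltr0_norm//.
by congr (_, _); rewrite ?mulNr ?opprK mulrC divfK.
Qed.

End SecondGradOps.


(** * The extremal map and its competitors *)

Section Extremal.
Context {R : realType} {H : normedModType R} (dot : {dot H for idfun}).
Hypothesis norm_dot : forall x : H, `|x| ^+ 2 = dot x x.
Local Notation C := R[i].
Local Notation Re := complex.Re.
Local Notation Im := complex.Im.
Local Notation U := (@unit_disk R).

Variables (c u1 u2 : H) (rho : R) (a : C).
Hypothesis u11 : dot u1 u1 = 1.
Hypothesis u22 : dot u2 u2 = 1.
Hypothesis u12 : dot u1 u2 = 0.
Hypothesis cu1 : dot c u1 = 0.
Hypothesis cu2 : dot c u2 = 0.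
Hypothesis rho0 : 0 < rho.
Hypothesis rhoE : rho ^+ 2 = 1 - dot c c.
Hypothesis a1 : `|a| < 1.

Let al := Re a.
Let be := Im a.

Definition extremal (p : R * R) : H :=
  c + place (rho *: u1) (rho *: u2) (mob a (cplx p)).

Lemma normc_sqrE (z : C) : `|z| ^+ 2 = (Re z ^+ 2 + Im z ^+ 2)%:C%C.
Proof. by rewrite -add_Re2_Im2. Qed.

Lemma abs_lt1 (z : C) : `|z| < 1 -> Re z ^+ 2 + Im z ^+ 2 < 1.
Proof. by move=> z1; rewrite -ltcR -normc_sqrE expr_lt1. Qed.

Let ab1 : al ^+ 2 + be ^+ 2 < 1. Proof. exact: abs_lt1. Qed.

Lemma dot_frame (s t x y : R) :
  dot (c + (s *: u1 + t *: u2)) (c + (x *: u1 + y *: u2)) =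
  dot c c + (s * x + t * y).
Proof.
have u21 : dot u2 u1 = 0 by rewrite dotC.
have u1c : dot u1 c = 0 by rewrite dotC.
have u2c : dot u2 c = 0 by rewrite dotC.
by rewrite !dotE u11 u22 u12 u21 cu1 cu2 u1c u2c; ring.
Qed.

Lemma placeZ (w : C) : place (rho *: u1) (rho *: u2) w =
  (rho * Re w) *: u1 + (rho * Im w) *: u2.
Proof. by rewrite /place !scalerA ![_ * rho]mulrC. Qed.

Lemma dot_extremal p : dot (extremal p) (extremal p) =
  1 - rho ^+ 2 * (1 - (Re (mob a (cplx p)) ^+ 2 + Im (mob a (cplx p)) ^+ 2)).
Proof. by rewrite /extremal placeZ dot_frame rhoE; ring: rhoE. Qed.

Lemma extremal_lt1 p : U p -> `|extremal p| < 1.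
Proof.
move=> /unit_disk_cplx p1.
rewrite -(@expr_lt1 _ 2)// norm_dot dot_extremal.
have := abs_lt1 (mob_lt1 a1 p1); rewrite gtrBl => ?.
by rewrite mulr_gt0 ?exprn_gt0// subr_gt0.
Qed.

Lemma cplx_polar1 t : `|cplx (polar (1 : R) t)| = 1.
Proof.
by apply/eqP; rewrite -sqrp_eq1// normc_sqrE /= !mul1r cos2Dsin2.
Qed.

Lemma extremal_circle t : dot (extremal (polar 1 t)) (extremal (polar 1 t)) = 1.
Proof.
have m1 := mob_eq1 a1 (cplx_polar1 t).
rewrite dot_extremal; have := normc_sqrE (mob a (cplx (polar 1 t))).
by rewrite m1 expr1n => -[<-]; ring.
Qed.

Lemma extremal0 : extremal 0 = c + place (rho *: u1) (rho *: u2) a.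
Proof.
rewrite /extremal /mob; have -> : cplx (0 : R * R) = 0 by [].
by rewrite add0r mulr0 addr0 divr1.
Qed.

(** This is [`|1 + a^* z| ^+ 2] at the point of angle [t] of the unit circle. *)
Definition weight (t : R) : R :=
  1 + (al ^+ 2 + be ^+ 2) + 2 * (al * cos t + be * sin t).

(** The Fourier coefficients of the weighted extremal map on the circle, obtained
    by expanding [z + 2 a + a ^+ 2 z^*] into its real and imaginary parts. *)
Definition trig0 := (1 + (al ^+ 2 + be ^+ 2)) *: c +
  ((2 * rho * al) *: u1 + (2 * rho * be) *: u2).
Definition trig1 := (2 * al) *: c + ((rho * (1 + al ^+ 2 - be ^+ 2)) *: u1 +
  (rho * (2 * al * be)) *: u2).
Definition trig2 := (2 * be) *: c + ((rho * (2 * al * be)) *: u1 +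
  (rho * (1 - al ^+ 2 + be ^+ 2)) *: u2).

(** On the circle [z^* = z^-1], so the weight clears the denominator of the
    Moebius map and leaves a trigonometric polynomial of degree one. *)
Lemma mob_circle (z : C) : `|z| = 1 ->
  (1 + (a^*)%C * z) * (1 + a * (z^*)%C) * mob a z = z + 2 * a + a ^+ 2 * (z^*)%C.
Proof.
move=> z1; have d0 : 1 + (a^*)%C * z != 0 by apply: mob_den_neq0; rewrite ?z1.
have zz : z * (z^*)%C = 1 by rewrite -sqr_normc z1 expr1n.
rewrite /mob mulrAC [X in X * _]mulrC divfK// mulrC.
have -> : (1 + a * (z^*)%C) * (z + a) = z + a + a * (z * (z^*)%C) + a ^+ 2 * (z^*)%C.
  by ring.
by rewrite zz; ring.
Qed.

Lemma weight_extremal t :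
  weight t *: extremal (polar 1 t) = trig0 + (cos t *: trig1 + sin t *: trig2).
Proof.
have := mob_circle (cplx_polar1 t).
have -> : (1 + (a^*)%C * cplx (polar 1 t)) * (1 + a * ((cplx (polar 1 t))^*)%C) =
    (weight t)%:C%C.
  rewrite /weight /al /be; case: (a) => x y; apply/eqP; rewrite eq_complex /=.
  apply/andP; split; apply/eqP; last by ring.
  rewrite -[X in _ = 1 + X + _]mulr1 -[X in _ = 1 + _ * X + _](cos2Dsin2 t).
  ring.
rewrite /extremal placeZ; case: (mob a _) => X Y /eqP; rewrite eq_complex /=.
have -> : a = Complex al be by rewrite /al /be; case: (a).
rewrite /= => /andP[/eqP EX /eqP EY].
rewrite /trig0 /trig1 /trig2 scalerDr scalerDr !scalerA.
have -> : weight t * (rho * X) = rho * (cos t + 2 * al + (al ^+ 2 - be ^+ 2) * cos t +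
    2 * al * be * sin t).
  rewrite mulrCA; congr (rho * _); lra.
have -> : weight t * (rho * Y) = rho * (sin t + 2 * be + 2 * al * be * cos t -
    (al ^+ 2 - be ^+ 2) * sin t).
  rewrite mulrCA; congr (rho * _); lra.
have comb (x y z x' y' z' : R) : (x *: c + (y *: u1 + z *: u2)) +
    (x' *: c + (y' *: u1 + z' *: u2)) =
    (x + x') *: c + ((y + y') *: u1 + (z + z') *: u2).
  by rewrite !scalerDl addrACA; congr (_ + _); rewrite addrACA.
rewrite !scalerDr !scalerA !comb /weight.
by congr (_ *: _ + (_ *: _ + _ *: _)); ring.
Qed.

Let n2 := al ^+ 2 + be ^+ 2.

Lemma weight_lower_bound : exists2 w0, 0 < w0 & forall t, w0 <= weight t.
Proof.
have n0 : 0 <= n2 by rewrite addr_ge0// sqr_ge0.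
pose n := Num.sqrt n2.
have nn : n ^+ 2 = n2 by rewrite sqr_sqrtr.
have nge : 0 <= n by exact: sqrtr_ge0.
have n1 : n < 1 by rewrite -(sqrtr1 R) ltr_sqrt.
exists ((1 - n) ^+ 2); first by rewrite exprn_gt0// subr_gt0.
move=> t; have H1 : (al * cos t + be * sin t) ^+ 2 <= n ^+ 2.
  rewrite nn -[leRHS]mulr1 -(cos2Dsin2 t) -subr_ge0.
  have -> : n2 * (cos t ^+ 2 + sin t ^+ 2) - (al * cos t + be * sin t) ^+ 2 =
    (al * sin t - be * cos t) ^+ 2 by rewrite /n2; ring.
  exact: sqr_ge0.
have H2 : - n <= al * cos t + be * sin t.
  rewrite lerNl; apply: (le_trans (ler_norm _)); rewrite normrN.
  by rewrite -(@ler_pXn2r _ 2)// ?nnegrE// real_normK ?num_real.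
rewrite /weight -/n2 -nn; lra.
Qed.

Lemma weight_continuous : continuous weight.
Proof.
move=> t; apply: cvgD; first exact: cvg_cst.
apply: cvgM; first exact: cvg_cst.
apply: cvgD; apply: cvgM; try exact: cvg_cst; first exact: continuous_cos.
exact: continuous_sin.
Qed.

Lemma weight_int : turn_int weight = pi *+ 2 * (1 + n2).
Proof.
have dw (t : R) : is_derive t 1
    (fun t => (1 + n2) * t + 2 * (al * sin t + - be * cos t)) (weight t).
  by apply: is_derive_eq; rewrite /weight /GRing.scale/= /n2; ring.
rewrite (turn_int_deriv dw weight_continuous) sin2pi cos2pi sin0 cos0; ring.
Qed.

(** Harmonic maps into the ball with the same value as [extremal] at the origin
    and a differential there proportional to its differential. *)
Definition competitor (F : R * R -> H) (lam : R) :=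
  exists Fx Fy Fxx Fxy Fyx Fyy,
  [/\ second_grad U F Fx Fy Fxx Fxy Fyx Fyy,
      forall z, U z -> Fxx z + Fyy z = 0,
      forall z, U z -> `|F z| < 1,
      F 0 = extremal 0
    & Fx 0 = lam *: u1 /\ Fy 0 = lam *: u2].

Lemma unit_disk0 : U (0 : R * R).
Proof. by rewrite unit_diskE /= expr0n /= addr0. Qed.

(** The nonnegative integral that compares [F] on the circle of radius [r] with
    the boundary values of [extremal]. *)
Definition gap (F : R * R -> H) (r : R) :=
  turn_int (fun t =>
    weight t * (1 - dot (F (polar r t)) (extremal (polar 1 t)))).

Lemma gap_integrandE F r t :
  weight t * (1 - dot (F (polar r t)) (extremal (polar 1 t))) =
  weight t + -1 * (dot (F (polar r t)) trig0 * 1 +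
    (dot (F (polar r t)) trig1 * cos t + dot (F (polar r t)) trig2 * sin t)).
Proof.
rewrite mulrBr -dotZr weight_extremal dotDr.
by rewrite (dotDr dot (cos t *: trig1)) (dotZr dot (cos t)) (dotZr dot (sin t)); ring.
Qed.

Lemma gap_integrand_continuous F lam r : competitor F lam -> -1 < r < 1 ->
  continuous (fun t : R =>
    weight t * (1 - dot (F (polar r t)) (extremal (polar 1 t)))).
Proof.
move=> [Fx [Fy [Fxx [Fxy [Fyx [Fyy [F2 _ _ _ _]]]]]]] r1.
have cF e z : U z -> {for z, continuous (fun z => dot (F z) e)}.
  by move=> Uz; exact: has_grad_continuous (grad_f (second_grad_dot norm_dot e F2)) Uz.
have k0 := circ_integrand_continuous (cF trig0) (@cst_continuous _ _ (1 : R)) r1.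
have k1 := circ_integrand_continuous (cF trig1) (@continuous_cos R) r1.
have k2 := circ_integrand_continuous (cF trig2) (@continuous_sin R) r1.
under [X in continuous X]eq_fun do rewrite gap_integrandE.
move=> t; apply: cvgD; first exact: weight_continuous.
apply: cvgM; first exact: cvg_cst.
apply: cvgD; first exact: k0.
by apply: cvgD; [exact: k1|exact: k2].
Qed.

(** Because the weighted boundary map has degree one, only the mean and the first
    Fourier coefficients of [F] contribute. *)
Lemma gapE F lam r : competitor F lam -> 0 <= r < 1 ->
  gap F r = pi *+ 2 * (rho * (rho * (1 - n2) - r * lam)).
Proof.
move=> [Fx [Fy [Fxx [Fxy [Fyx [Fyy [F2 lap _ F0 [Fx0 Fy0]]]]]]]] r1.
have r1' : -1 < r < 1 by lra.
have S e := second_grad_dot norm_dot e F2.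
have L e z : U z -> dot (Fxx z) e + dot (Fyy z) e = 0.
  by move=> Uz; rewrite -dotDl lap// dot0l.
have cF e z : U z -> {for z, continuous (fun z => dot (F z) e)}.
  by move=> Uz; exact: has_grad_continuous (grad_f (S e)) Uz.
have k0 := circ_integrand_continuous (cF trig0) (@cst_continuous _ _ (1 : R)) r1'.
have k1 := circ_integrand_continuous (cF trig1) (@continuous_cos R) r1'.
have k2 := circ_integrand_continuous (cF trig2) (@continuous_sin R) r1'.
have cD (f g : R -> R) : continuous f -> continuous g ->
    continuous (fun t => f t + g t).
  by move=> cf cg t; apply: cvgD; [exact: cf|exact: cg].
have cZ (k : R) (f : R -> R) : continuous f -> continuous (fun t => k * f t).
  by move=> cf t; apply: cvgM; [exact: cvg_cst|exact: cf].
have I : gap F r = turn_int (fun t => weight t + -1 * (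
    dot (F (polar r t)) trig0 * 1 + (dot (F (polar r t)) trig1 * cos t +
    dot (F (polar r t)) trig2 * sin t))).
  by apply: eq_turn_int => t; exact: gap_integrandE.
rewrite I turn_intD; [|exact: weight_continuous|exact/cZ/cD/cD].
rewrite weight_int turn_intZ; last exact/cD/cD.
rewrite turn_intD; [|exact: k0|exact: cD].
rewrite turn_intD//.
have h0 := harmonic_circ_mean (S trig0) (L trig0) r1.
have h1 := harmonic_cos_coef (S trig1) (L trig1) r1.
have h2 := harmonic_sin_coef (S trig2) (L trig2) r1.
rewrite /circ in h0 h1 h2; rewrite h0 h1 h2.
rewrite F0 Fx0 Fy0 extremal0 placeZ /trig0 /trig1 /trig2 !dotE.
have u21 : dot u2 u1 = 0 by rewrite dotC.
have u1c : dot u1 c = 0 by rewrite dotC.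
have u2c : dot u2 c = 0 by rewrite dotC.
rewrite u11 u22 u12 u21 cu1 cu2 u1c u2c -/al -/be.
have -> : dot c c = 1 - rho ^+ 2 by rewrite rhoE; ring.
by rewrite /n2 mulr2n; ring.
Qed.

(** The boundary values of [extremal] are unit vectors and [F] takes values in
    the ball, so [1 - dot F f] dominates half of the squared distance. *)
Lemma gap_integrand_ge F r t : (forall z, U z -> `|F z| < 1) -> -1 < r < 1 ->
  let d := F (polar r t) - extremal (polar 1 t) in
  dot d d <= 2 * (1 - dot (F (polar r t)) (extremal (polar 1 t))).
Proof.
move=> F1 r1 /=; rewrite dotBB extremal_circle.
have : dot (F (polar r t)) (F (polar r t)) < 1.
  by rewrite -norm_dot expr_lt1//; apply/F1/polar_disk.
lra.
Qed.

Lemma gap_ge0 F r : (forall z, U z -> `|F z| < 1) -> -1 < r < 1 -> 0 <= gap F r.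
Proof.
move=> F1 r1; apply: turn_int_ge0 => t; have [w0 w0p w0le] := weight_lower_bound.
apply: mulr_ge0; first exact/ltW/(lt_le_trans w0p).
have /= := gap_integrand_ge t F1 r1.
have := dot_ge0 norm_dot (F (polar r t) - extremal (polar 1 t)); lra.
Qed.

(** If [lam] exceeded the bound, a radius [r < 1] with [r lam] halfway between the
    two would make the gap negative. *)
Lemma competitor_le F lam : competitor F lam -> lam <= rho * (1 - n2).
Proof.
move=> FF; have F1 : forall z, U z -> `|F z| < 1.
  by case: FF => [? [? [? [? [? [? []]]]]]].
have b0 : 0 < rho * (1 - n2) by rewrite mulr_gt0// subr_gt0.
rewrite leNgt; apply/negP => lt.
have l0 : 0 < lam by lra.
pose r := (rho * (1 - n2) / lam + 1) / 2.
have [q0 q1] : 0 < rho * (1 - n2) / lam /\ rho * (1 - n2) / lam < 1.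
  by rewrite divr_gt0// ltr_pdivrMr// mul1r.
have r1 : 0 <= r < 1 by rewrite /r; lra.
have r1' : -1 < r < 1 by lra.
have p0 : 0 < pi *+ 2 :> R by rewrite mulrn_wgt0// pi_gt0.
have := gap_ge0 F1 r1'; rewrite (gapE FF r1) (pmulr_rge0 _ p0) (pmulr_rge0 _ rho0).
have -> : r * lam = (rho * (1 - n2) + lam) / 2.
  by rewrite /r; field; rewrite gt_eqF.
lra.
Qed.

Lemma mob1_0 : mob1 a 0 = (1 - n2)%:C%C.
Proof.
rewrite /mob1 mulr0 addr0 expr1n divr1 -sqr_normc normc_sqrE -/al -/be.
by rewrite rmorphB.
Qed.

Lemma extremal_harmonic : exists Fx Fy Fxx Fxy Fyx Fyy,
  [/\ second_grad U extremal Fx Fy Fxx Fxy Fyx Fyy,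
      forall z, U z -> Fxx z + Fyy z = 0,
      Fx 0 = (rho * (1 - n2)) *: u1 & Fy 0 = (rho * (1 - n2)) *: u2].
Proof.
have S := hol2_second_grad c (rho *: u1) (rho *: u2) (mob_hol2 a1).
have UE : cplx @^-1` [set z : C | `|z| < 1] = U.
  by apply/seteqP; split => z /=; rewrite -unit_disk_cplx.
rewrite UE in S; do 6 eexists; split; first exact: S.
- by move=> z _; rewrite subrr.
- have -> : cplx (0 : R * R) = 0 by [].
  by rewrite mob1_0 placeZ /= mulr0 scale0r addr0.
- have -> : cplx (0 : R * R) = 0 by [].
  rewrite mob1_0 mulic placeZ /= oppr0 mulr0 scale0r add0r //.
Qed.

Lemma extremal_competitor : competitor extremal (rho * (1 - n2)).
Proof.
have [Fx [Fy [Fxx [Fxy [Fyx [Fyy [S L X Y]]]]]]] := extremal_harmonic.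
exists Fx, Fy, Fxx, Fxy, Fyx, Fyy; split => //.
by move=> z; exact: extremal_lt1.
Qed.

(** Both [F] and [extremal] have a gap proportional to [1 - r], and their distance
    on the circle of radius [r] is at most the sum of their distances to the
    boundary values of [extremal]. Hence the mean [A r] of the square of a
    component of [F - extremal] is at most [K (1 - r)]; being nondecreasing in
    [r] and nonnegative, it is zero. *)
Lemma competitor_unique F : competitor F (rho * (1 - n2)) ->
  forall z, U z -> F z = extremal z.
Proof.
move=> FF; have FE := extremal_competitor.
case: (FF) => [Fx [Fy [Fxx [Fxy [Fyx [Fyy [F2 lapF F1 _ _]]]]]]].
case: (FE) => [Ex [Ey [Exx [Exy [Eyx [Eyy [E2' lapE E1' _ _]]]]]]].
have [w0 w0p w0le] := weight_lower_bound.
suff key e z0 : U z0 -> dot (F z0 - extremal z0) e = 0.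
  move=> z Uz; apply/eqP; rewrite -subr_eq0 -normr_eq0 -sqrf_eq0 norm_dot.
  by rewrite key.
pose u z := dot ((F - extremal) z) e.
have S := second_grad_dot norm_dot e (second_gradB F2 E2').
have Q := second_grad_sqr S.
have lapQ z : U z -> 0 <= 2 * (dot ((Fx - Ex) z) e * dot ((Fx - Ex) z) e +
     u z * dot ((Fxx - Exx) z) e) + 2 * (dot ((Fy - Ey) z) e * dot ((Fy - Ey) z) e +
     u z * dot ((Fyy - Eyy) z) e).
  move=> Uz; have : dot ((Fxx - Exx) z) e + dot ((Fyy - Eyy) z) e = 0.
    rewrite -dotDl !fctE addrACA -opprD lapF// lapE// subrr dot0l //.
  move=> lap.
  set X := dot _ e; set Y := dot _ e in lap *; set Z := dot ((Fy - Ey) z) e.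
  set T := dot _ e in lap *.
  have -> : 2 * (X * X + u z * Y) + 2 * (Z * Z + u z * T) =
    2 * (X ^+ 2 + Z ^+ 2 + u z * (Y + T)) by ring.
  by rewrite lap mulr0 addr0 mulr_ge0// addr_ge0// sqr_ge0.
pose A := circ (fun z => u z * u z) (cst 1).
pose K := dot e e * 4 / w0 * (pi *+ 2 * (rho * (rho * (1 - n2)))) * 2.
have cQ z : U z -> {for z, continuous (fun z => u z * u z)}.
  by move=> Uz; exact: has_grad_continuous (grad_f Q) Uz.
have AleK r : 0 <= r < 1 -> A r <= K * (1 - r).
  move=> r1; have r1' : -1 < r < 1 by lra.
  have cF := gap_integrand_continuous FF r1'; have cE := gap_integrand_continuous FE r1'.
  have k0 : 0 <= dot e e * 4 / w0.
    by rewrite divr_ge0 ?mulr_ge0 ?dot_ge0// ltW.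
  apply: (@le_trans _ _ (dot e e * 4 / w0 * (gap F r + gap extremal r))); last first.
    rewrite (gapE FF r1) (gapE FE r1) le_eqVlt; apply/orP; left; apply/eqP.
    by rewrite /K; ring.
  have cFE : continuous (fun t =>
     weight t * (1 - dot (F (polar r t)) (extremal (polar 1 t))) +
     weight t * (1 - dot (extremal (polar r t)) (extremal (polar 1 t)))).
    by move=> t; apply: cvgD; [exact: cF|exact: cE].
  rewrite /gap -turn_intD// -turn_intZ//.
  apply: le_turn_int.
  - exact: circ_integrand_continuous cQ (@cst_continuous _ _ (1 : R)) r1'.
  - by move=> t; apply: cvgM; [exact: cvg_cst|exact: cFE].
  move=> t; rewrite /= mulr1.
  have := gap_integrand_ge t F1 r1'; have := gap_integrand_ge t E1' r1'.
  move=> /=; set X := 1 - dot (extremal (polar r t)) _; set Y := 1 - dot (F _) _.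
  set d2 := extremal (polar r t) - _; set d1 := F (polar r t) - _ => hX hY.
  have dE : (F - extremal) (polar r t) = d1 - d2.
    by rewrite !fctE /d1 /d2 opprB addrA subrK.
  clearbody d1 d2.
  have h1 := dot_ge0 norm_dot d1; have h2 := dot_ge0 norm_dot d2.
  have X0 : 0 <= X by lra.
  have Y0 : 0 <= Y by lra.
  have h3 : dot (d1 - d2) (d1 - d2) <= 4 * (Y + X).
    have := dot_ge0 norm_dot (d1 - - d2).
    by rewrite !dotBB (dotNr dot d2 d1) (dotNr dot d2 (- d2)) (dotNl dot d2 d2); lra.
  have h4 : w0 * (Y + X) <= weight t * Y + weight t * X.
    by rewrite -mulrDr ler_wpM2r// addr_ge0.
  rewrite /u dE -expr2; apply: (le_trans (dot_sqr_le norm_dot _ _)).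
  rewrite mulrC -!mulrA ler_wpM2l ?dot_ge0//.
  apply: (le_trans h3); rewrite ler_wpM2l//.
  by rewrite mulrC ler_pdivlMr// mulrC.
have A0 r : 0 <= r < 1 -> A r = 0.
  move=> r1; apply/eqP; rewrite eq_le; apply/andP; split; last first.
    by apply: turn_int_ge0 => t; rewrite mulr1 -expr2 sqr_ge0.
  have K0 : 0 <= K.
    have := AleK 0; rewrite lexx ltr01 subr0 mulr1 => /(_ isT); apply: le_trans.
    by apply: turn_int_ge0 => t; rewrite mulr1 -expr2 sqr_ge0.
  apply/ler_addgt0Pr => d d0; rewrite add0r.
  (* a radius beyond r at which the upper bound K (1 - s) is below d *)
  pose s := Num.max r (1 - d / (K + 1)).
  have dK : 0 < d / (K + 1) by rewrite divr_gt0//; lra.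
  have s1 : s < 1 by rewrite gt_max; apply/andP; split; lra.
  have rs : r <= s by rewrite le_max lexx.
  have sd : 1 - d / (K + 1) <= s by rewrite le_max lexx orbT.
  apply: (@le_trans _ _ (A s)).
    apply: (subharmonic_mean_le Q) => //; lra.
  apply: (le_trans (AleK s _)); first lra.
  apply: (@le_trans _ _ (K * (d / (K + 1)))); first by apply: ler_wpM2l => //; lra.
  rewrite mulrA ler_pdivrMr; last lra.
  nra.
move=> Uz; have [r [t [r1 t1 ->]]] := polar_surj Uz.
have r1' : -1 < r < 1 by lra.
have cQr := circ_integrand_continuous cQ (@cst_continuous _ _ (1 : R)) r1'.
have := turn_int_eq0 cQr _ (A0 r r1) t1.
rewrite /= mulr1 => /(_ _)/eqP.
rewrite mulf_eq0 orbb => H0; apply/eqP/H0 => t'.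
by rewrite mulr1 -expr2 sqr_ge0.
Qed.

End Extremal.


(** * Orthonormal frames, and sharpness *)

Section Frames.
Context {R : realType} {H : normedModType R} (dot : {dot H for idfun}).
Hypothesis norm_dot : forall x : H, `|x| ^+ 2 = dot x x.
Local Notation C := R[i].
Local Notation Re := complex.Re.
Local Notation Im := complex.Im.
Local Notation U := (@unit_disk R).

Lemma eucl_norm_sqr (v : R * R) : eucl_norm v ^+ 2 = v.1 ^+ 2 + v.2 ^+ 2.
Proof. by rewrite sqr_sqrtr// addr_ge0// sqr_ge0. Qed.

Section Frame.
Variables (u1 u2 : H).
Hypothesis u11 : dot u1 u1 = 1.
Hypothesis u22 : dot u2 u2 = 1.
Hypothesis u12 : dot u1 u2 = 0.

Let u21 : dot u2 u1 = 0. Proof. by rewrite dotC. Qed.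

Lemma orth_proj_span p :
  orth_proj dot (span2 u1 u2) p = dot p u1 *: u1 + dot p u2 *: u2.
Proof.
rewrite /orth_proj; set P := (X in xget _ X); set y := _ + _.
have Py : P y.
  split; first by exists (dot p u1), (dot p u2).
  by move=> z [s [t ->]]; rewrite /y !dotE u11 u22 u12 u21; ring.
apply: xget_unique => // z [[s [t zE]] zP].
have z1 : span2 u1 u2 u1 by exists 1, 0; rewrite scale1r scale0r addr0.
have z2 : span2 u1 u2 u2 by exists 0, 1; rewrite scale1r scale0r add0r.
have := zP _ z1; have := zP _ z2.
rewrite zE !dotE u11 u22 u12 u21 /y => h2 h1.
by congr (_ *: _ + _ *: _); lra.
Qed.

(** Here [c] is the component of [p] orthogonal to the plane, and [rho] the radius
    of the affine disk; [a] locates [p] in this disk, rescaled to the unit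
    disk. *)
Lemma frame_exists p : `|p| < 1 -> exists c rho (a : C),
  [/\ dot c u1 = 0 /\ dot c u2 = 0, 0 < rho, rho ^+ 2 = 1 - dot c c,
      `|a| < 1 /\ p = c + place (rho *: u1) (rho *: u2) a
    & conformal_bound dot p (span2 u1 u2) =
      rho * (1 - (Re a ^+ 2 + Im a ^+ 2))].
Proof.
move=> p1; pose q := dot p u1 *: u1 + dot p u2 *: u2; pose c := p - q.
have cu1 : dot c u1 = 0 by rewrite /c /q !dotE u11 u21; ring.
have cu2 : dot c u2 = 0 by rewrite /c /q !dotE u12 u22; ring.
have pE : p = c + q by rewrite subrK.
have qq : dot q q = dot p u1 ^+ 2 + dot p u2 ^+ 2.
  by rewrite /q !dotE u11 u22 u12 u21; ring.
have cq : dot c q = 0 by rewrite /q dotDr 2!dotZr cu1 cu2; ring.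
clearbody c.
have pp : dot p p = dot c c + dot q q.
  rewrite {1 2}pE (dotDl dot c q (c + q)) (dotDr dot c q c) (dotDr dot c q q).
  by rewrite (dotC dot q c) cq; ring.
have pp1 : dot p p < 1 by rewrite -norm_dot expr_lt1.
have qq0 := dot_ge0 norm_dot q.
have r20 : 0 < 1 - dot c c by lra.
pose rho := Num.sqrt (1 - dot c c).
have rho0 : 0 < rho by rewrite sqrtr_gt0.
have rr : rho ^+ 2 = 1 - dot c c by rewrite sqr_sqrtr// ltW.
have rn0 : rho != 0 by rewrite gt_eqF.
exists c, rho, (Complex (dot p u1 / rho) (dot p u2 / rho)).
have nE : (dot p u1 / rho) ^+ 2 + (dot p u2 / rho) ^+ 2 = dot q q / rho ^+ 2.
  by rewrite qq; field.
split => //.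
- split.
    rewrite -(@expr_lt1 _ 2)// normc_sqrE /= nE ltcR ltr_pdivrMr ?exprn_gt0// rr; lra.
  rewrite placeZ /= {1}pE /q; congr (_ + (_ *: _ + _ *: _)).
    by rewrite mulrC divfK.
  by rewrite mulrC divfK.
rewrite /conformal_bound orth_proj_span -/q !norm_dot /= nE.
have -> : 1 - dot p p + dot q q = rho ^+ 2 by rewrite pp rr; ring.
rewrite sqrtr_sqr gtr0_norm//.
have -> : 1 - dot p p = rho ^+ 2 - dot q q by rewrite pp rr; ring.
by field.
Qed.

End Frame.

Lemma gram_schmidt (L : set H) : is_plane L -> exists u1 u2,
  [/\ dot u1 u1 = 1, dot u2 u2 = 1, dot u1 u2 = 0 & L = span2 u1 u2].
Proof.
move=> [a [b [ab ->]]].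
have an0 : a != 0.
  apply/eqP => a0; have [] := ab 1 0; first by rewrite a0 scaler0 scale0r addr0.
  by move/eqP; rewrite oner_eq0.
have aa : 0 < dot a a by rewrite -norm_dot exprn_gt0// normr_gt0.
pose b' := b - (dot a b / dot a a) *: a.
have ab' : dot a b' = 0 by rewrite /b' dotDr dotNr dotZr divfK ?gt_eqF// subrr.
have bn0 : b' != 0.
  apply/eqP => b0; have [] := ab (- (dot a b / dot a a)) 1.
    by rewrite scale1r scaleNr addrC -/b' b0.
  by move=> _ /eqP; rewrite oner_eq0.
have na : `|a| != 0 by rewrite normr_eq0.
have nb : `|b'| != 0 by rewrite normr_eq0.
exists (`|a|^-1 *: a), (`|b'|^-1 *: b').
split.
- by rewrite dotZl dotZr -norm_dot; field.
- by rewrite dotZl dotZr -norm_dot; field.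
- by rewrite dotZl dotZr ab' !mulr0.
apply/seteqP; split=> x [s [t ->]].
- exists (`|a| * (s + t * (dot a b / dot a a))), (`|b'| * t).
  rewrite !scalerA !(mulrAC _ _ _^-1) !divff// !mul1r /b' scalerBr scalerDl scalerA.
  by rewrite addrACA subrr addr0.
- exists (s / `|a| - t / `|b'| * (dot a b / dot a a)), (t / `|b'|).
  by rewrite !scalerA {2}/b' scalerBr scalerBl scalerA addrA addrAC.
Qed.

Lemma frame_norm u1 u2 (b x y : R) : dot u1 u1 = 1 -> dot u2 u2 = 1 ->
  dot u1 u2 = 0 -> 0 <= b ->
  `|x *: (b *: u1) + y *: (b *: u2)| = b * eucl_norm (x, y).
Proof.
move=> u11 u22 u12 b0; have u21 : dot u2 u1 = 0 by rewrite dotC.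
apply/eqP; rewrite -(@eqrXn2 _ 2)// ?mulr_ge0 ?sqrtr_ge0//; apply/eqP.
by rewrite norm_dot exprMn eucl_norm_sqr !dotE u11 u22 u12 u21 /=; ring.
Qed.

Lemma extremal_sharp p (L : set H) : `|p| < 1 -> is_plane L ->
  exists F : R * R -> H,
    [/\ harmonic_on U F, forall z, U z -> `|F z| < 1, F 0 = p,
        conformal_with_factor ('d F (0 : R * R)) (conformal_bound dot p L)
      & range ('d F (0 : R * R)) = L].
Proof.
move=> p1 /gram_schmidt[u1 [u2 [u11 u22 u12 ->]]].
have [c [rho [a [[cu1 cu2] rho0 rhoE [a1 pE] ->]]]] := frame_exists u11 u22 u12 p1.
have [Fx [Fy [Fxx [Fxy [Fyx [Fyy [F2 lap Fx0 Fy0]]]]]]] :=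
  extremal_harmonic c u1 u2 rho a1.
set b := rho * _ in Fx0 Fy0 *.
have b0 : 0 < b by rewrite mulr_gt0// subr_gt0 abs_lt1.
have dE : 'd (extremal c u1 u2 rho a) (0 : R * R) =
    (fun h => h.1 *: (b *: u1) + h.2 *: (b *: u2)) :> (R * R -> H).
  by have [_ ->] := grad_f F2 (@unit_disk0 R); rewrite Fx0 Fy0.
have nE v : `|'d (extremal c u1 u2 rho a) (0 : R * R) v| = b * eucl_norm v.
  by rewrite dE frame_norm ?ltW//; case: v.
exists (extremal c u1 u2 rho a); split.
- exact: second_grad_harmonic open_unit_disk F2 lap.
- by move=> z; exact: extremal_lt1.
- by rewrite extremal0 -pE.
- split=> //; exists (1, 0); rewrite -normr_gt0 nE mulr_gt0// sqrtr_gt0 /=.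
  by rewrite expr1n expr0n addr0.
rewrite dE; apply/seteqP; split=> x.
  by move=> [[s t] _ /= <-]; exists (s * b), (t * b); rewrite !scalerA.
move=> [s [t ->]]; exists (s / b, t / b) => //=.
by rewrite !scalerA !divfK ?gt_eqF.
Qed.

(** Taking the images of the two coordinate vectors as the directions of the basis
    absorbs rotations and reflections, so that the estimate treats both
    orientations at once. *)
Lemma conformal_frame (A B : H) (L : R * R -> H) lam :
  (forall h, L h = h.1 *: A + h.2 *: B) -> conformal_with_factor L lam ->
  exists u1 u2, [/\ dot u1 u1 = 1, dot u2 u2 = 1, dot u1 u2 = 0,
    A = lam *: u1 /\ B = lam *: u2 & range L = span2 u1 u2].
Proof.
move=> LE [_ lam0 Ln].
have sq h : dot (L h) (L h) = lam ^+ 2 * (h.1 ^+ 2 + h.2 ^+ 2).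
  by rewrite -norm_dot Ln exprMn eucl_norm_sqr.
have AA : dot A A = lam ^+ 2.
  by have := sq (1, 0); rewrite LE /= scale1r scale0r addr0 => ->; ring.
have BB : dot B B = lam ^+ 2.
  by have := sq (0, 1); rewrite LE /= scale1r scale0r add0r => ->; ring.
have AB : dot A B = 0.
  have := sq (1, 1); rewrite LE /= !scale1r dotDl !dotDr AA BB (dotC dot B A).
  lra.
have ln0 : lam != 0 by rewrite gt_eqF.
exists (lam^-1 *: A), (lam^-1 *: B).
rewrite !scalerA divff// !scale1r; split => //.
- by rewrite dotZl dotZr AA; field.
- by rewrite dotZl dotZr BB; field.
- by rewrite dotZl dotZr AB !mulr0.
apply/seteqP; split=> x.
  move=> [h _ <-]; exists (h.1 * lam), (h.2 * lam).
  by rewrite LE !scalerA !mulfK.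
move=> [s [t ->]]; exists (s / lam, t / lam) => //.
by rewrite LE /= !scalerA.
Qed.

End Frames.


(** * The extremal map is a conformal diffeomorphism *)

Section ExtremalDiffeo.
Context {R : realType} {H : normedModType R} (dot : {dot H for idfun}).
Hypothesis norm_dot : forall x : H, `|x| ^+ 2 = dot x x.
Local Notation C := R[i].
Local Notation Re := complex.Re.
Local Notation Im := complex.Im.
Local Notation U := (@unit_disk R).
Local Notation D := (@pair_of_complex R @^-1` @unit_disk R).

Lemma set_bij_coord (A : Type) (B : set A) (V : set H) (f : A -> H) p e1 e2 :
  {in V &, injective (plane_coord dot p e1 e2)} ->
  set_bij B V f -> set_bij B (plane_coord dot p e1 e2 @` V)
    (fun z => plane_coord dot p e1 e2 (f z)).
Proof.
move=> inj [fV fI fS]; split.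
- by move=> z Bz; exists (f z) => //; exact: fV.
- move=> x y Bx By E; apply: fI => //; apply: inj => //.
    by apply/mem_set/fV/set_mem.
  by apply/mem_set/fV/set_mem.
- by move=> _ [x Vx <-]; have [z Bz <-] := fS x Vx; exists z.
Qed.

Lemma set_bij_pair (V : set H) (F : R * R -> H) : set_bij U V F ->
  set_bij D V (fun z => F (pair_of_complex z)).
Proof.
move=> [FV FI FS]; split.
- by move=> z Dz; exact: FV.
- move=> x y /set_mem Dx /set_mem Dy E.
  by rewrite -(pair_of_complexK x) -(pair_of_complexK y) (FI _ _ _ _ E)//; exact/mem_set.
- by move=> x Vx; have [z Uz <-] := FS x Vx; exists (cplx z); rewrite /= ?cplxK.
Qed.

Lemma pair_of_complex_continuous :
  continuous (@pair_of_complex R : C^o -> (R * R)%type).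
Proof.
move=> z; apply: (@continuous_pair_for _ C^o (@complex.Re R) (@complex.Im R)).
  exact: Re_continuous.
exact: Im_continuous.
Qed.

Lemma near_disk (z : C) : D z -> \forall w \near (z : C^o), D w.
Proof.
move=> Dz; apply: pair_of_complex_continuous.
exact: open_nbhs_nbhs (conj open_unit_disk Dz).
Qed.

Section FrameE.
Variables (e1 e2 : H).
Hypothesis e11 : dot e1 e1 = 1.
Hypothesis e22 : dot e2 e2 = 1.
Hypothesis e12 : dot e1 e2 = 0.

Let e21 : dot e2 e1 = 0. Proof. by rewrite dotC. Qed.

Lemma plane_coord_inj p : {in affine_disk p (span2 e1 e2) &,
  injective (plane_coord dot p e1 e2)}.
Proof.
move=> x y /set_mem[[s [t xE]] _] /set_mem[[s' [t' yE]] _].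
rewrite /plane_coord xE yE => /eqP.
rewrite eq_complex /= !dotE e11 e22 e12 e21 => /andP[/eqP E1 /eqP E2].
apply: (@addIr _ (- p)); rewrite xE yE; congr (_ *: _ + _ *: _); lra.
Qed.

Variables (k1 k2 : R) (c : H) (rho : R) (a : C).
Hypothesis k12 : k1 ^+ 2 + k2 ^+ 2 = 1.
Let u1 := k1 *: e1 + k2 *: e2.
Let u2 := - k2 *: e1 + k1 *: e2.
Hypothesis cu1 : dot c u1 = 0.
Hypothesis cu2 : dot c u2 = 0.
Hypothesis rho0 : 0 < rho.
Hypothesis rhoE : rho ^+ 2 = 1 - dot c c.
Hypothesis a1 : `|a| < 1.

Let u11 : dot u1 u1 = 1.
Proof. by rewrite /u1 !dotE e11 e22 e12 e21 -[RHS]k12; ring. Qed.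
Let u22 : dot u2 u2 = 1.
Proof. by rewrite /u2 !dotE e11 e22 e12 e21 -[RHS]k12; ring. Qed.
Let u12 : dot u1 u2 = 0.
Proof. by rewrite /u1 /u2 !dotE e11 e22 e12 e21; ring. Qed.

Let L := span2 e1 e2.
Let p := c + place (rho *: u1) (rho *: u2) a.
Local Notation E := (extremal c u1 u2 rho a).

Lemma plane_coord_place w :
  plane_coord dot p e1 e2 (c + place (rho *: u1) (rho *: u2) w) =
  (Complex k1 k2 * rho%:C%C) * (w - a).
Proof.
rewrite /plane_coord /p opprD addrACA subrr add0r !placeZ /u1 /u2.
rewrite !dotE e11 e22 e12 e21; case: w => x y; case: (a) => al be.
by apply/eqP; rewrite eq_complex /=; apply/andP; split; apply/eqP; ring.
Qed.

Lemma affine_disk_place w : `|w| < 1 ->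
  affine_disk p L (c + place (rho *: u1) (rho *: u2) w).
Proof.
move=> w1; split.
  rewrite /p opprD addrACA subrr add0r !placeZ /u1 /u2.
  exists (rho * (k1 * (Re w - Re a) - k2 * (Im w - Im a))).
  exists (rho * (k2 * (Re w - Re a) + k1 * (Im w - Im a))).
  rewrite opprD addrACA -!scalerBl !scalerDr !scalerA addrACA -!scalerDl.
  by congr (_ *: _ + _ *: _); ring.
rewrite -(@expr_lt1 _ 2)// norm_dot placeZ (dot_frame u11 u22 u12 cu1 cu2).
have -> : dot c c = 1 - rho ^+ 2 by rewrite rhoE; ring.
have := abs_lt1 w1; have : 0 < rho ^+ 2 by rewrite exprn_gt0.
nra.
Qed.

Lemma affine_disk_param x : affine_disk p L x ->
  exists2 w, `|w| < 1 & x = c + place (rho *: u1) (rho *: u2) w.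
Proof.
move=> [[s [t xE]] x1].
have rn0 : rho != 0 by rewrite gt_eqF.
pose w := Complex (Re a + (s * k1 + t * k2) / rho) (Im a + (t * k1 - s * k2) / rho).
have wE : x = c + place (rho *: u1) (rho *: u2) w.
  have -> : x = p + (s *: e1 + t *: e2) by rewrite -xE addrC subrK.
  have -> : s *: e1 + t *: e2 = (s * k1 + t * k2) *: u1 + (t * k1 - s * k2) *: u2.
    rewrite /u1 /u2 !scalerDr !scalerA addrACA -!scalerDl.
    have -> : (s * k1 + t * k2) * k1 + (t * k1 - s * k2) * - k2 =
       s * (k1 ^+ 2 + k2 ^+ 2) by ring.
    have -> : (s * k1 + t * k2) * k2 + (t * k1 - s * k2) * k1 =
       t * (k1 ^+ 2 + k2 ^+ 2) by ring.
    by rewrite k12 !mulr1.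
  rewrite /p -addrA; congr (_ + _).
  rewrite !placeZ /w /= !mulrDr !(mulrC rho (_ / rho)) !divfK// !(scalerDl u1).
  by rewrite !(scalerDl u2) addrACA.
exists w => //.
have : dot x x < 1 by rewrite -norm_dot expr_lt1.
rewrite wE placeZ (dot_frame u11 u22 u12 cu1 cu2).
have -> : dot c c = 1 - rho ^+ 2 by rewrite rhoE; ring.
have r2 : 0 < rho ^+ 2 by rewrite exprn_gt0.
move=> h; rewrite -(@expr_lt1 _ 2)// normc_sqrE ltcR -subr_gt0 -(pmulr_rgt0 _ r2).
lra.
Qed.

Lemma extremal_bij F : (forall z, U z -> F z = E z) ->
  set_bij U (affine_disk p L) F.
Proof.
move=> FE; split.
- move=> z Uz; rewrite FE//; apply: affine_disk_place; apply: mob_lt1 => //.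
  exact/unit_disk_cplx.
- move=> x y /set_mem Ux /set_mem Uy; rewrite !FE//.
  move=> /(congr1 (plane_coord dot p e1 e2)).
  rewrite !plane_coord_place => /mulfI H0.
  have {}H0 := H0 _; rewrite -(cplxK x) -(cplxK y); congr pair_of_complex.
  rewrite -(mobK a1 ((unit_disk_cplx _).1 Ux)) -(mobK a1 ((unit_disk_cplx _).1 Uy)).
  congr mob; apply: (@addIr _ (- a)); apply: H0.
  rewrite mulf_eq0 negb_or; apply/andP; split; last first.
    by rewrite eq_complex /= gt_eqF.
  apply/eqP => /eqP; rewrite eq_complex /= => /andP[/eqP k10 /eqP k20].
  by move: k12; rewrite k10 k20 expr0n addr0 => /eqP; rewrite eq_sym oner_eq0.
- move=> x /affine_disk_param[w w1 ->].
  have na1 : `|- a| < 1 by rewrite normrN.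
  have zU : U (pair_of_complex (mob (- a) w)).
    by apply/unit_disk_pair; exact: mob_lt1.
  exists (pair_of_complex (mob (- a) w)) => //.
  rewrite FE// /extremal pair_of_complexK.
  by rewrite -{1}(opprK a) mobK.
Qed.

(** In the coordinates of [e1], [e2] the map is a Moebius map followed by a
    similarity; its inverse is the inverse similarity followed by the Moebius map
    of parameter [- a]. The rotation [k1 + i k2] relates the given basis to the
    one in which the differential at the origin is a multiple of the
    identity. *)
Lemma extremal_conformal F : (forall z, U z -> F z = E z) ->
  conformal_diffeo dot p L e1 e2 F.
Proof.
move=> FE; have Fbij := extremal_bij FE; split=> //.
set s := Complex k1 k2 * rho%:C%C.
have s0 : s != 0.
  rewrite mulf_eq0 negb_or; apply/andP; split; last first.
    by rewrite eq_complex /= gt_eqF.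
  apply/eqP => /eqP; rewrite eq_complex /= => /andP[/eqP k10 /eqP k20].
  by move: k12; rewrite k10 k20 expr0n addr0 => /eqP; rewrite eq_sym oner_eq0.
have coE z : D z -> in_coord dot p e1 e2 F z = s * (mob a z - a).
  move=> Dz; rewrite /in_coord FE// /extremal pair_of_complexK.
  exact: plane_coord_place.
have na1 : `|- a| < 1 by rewrite normrN.
split.
- exact: set_bij_coord (@plane_coord_inj p) (set_bij_pair Fbij).
- move=> z Dz; have z1 : `|z| < 1 by exact/unit_disk_pair.
  have [dm _ _] := mob_hol2 a1 z1.
  apply: (@cderiv_derivable _ _ _ (s * mob1 a z)).
  apply: (@near_cderiv _ (fun w => s * (mob a w - a))).
    by apply: filterS (near_disk Dz) => w Dw; rewrite coE.
  apply: cderiv_eq (cderivM (cderiv_cst s z) (cderivD dm (cderiv_cst (- a) z))) _.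
  by rewrite mulr0 !addr0.
exists (fun w => mob (- a) (s^-1 * w + a)); split.
  move=> z /set_mem Dz; rewrite coE// mulKf// subrK mobK//.
  exact/unit_disk_pair.
move=> w [x /affine_disk_param[v v1 ->] <-]; rewrite plane_coord_place.
rewrite -/s; set w' := s * (v - a).
have wv : s^-1 * w' + a = v by rewrite mulKf// subrK.
have [dm _ _] := mob_hol2 na1 v1.
have da : cderiv (fun w => s^-1 * w + a) w' s^-1.
  have dM := cderivM (cderiv_cst s^-1 w') (cderiv_id w').
  apply: cderiv_eq (cderivD dM (cderiv_cst a w')) _.
  by rewrite mulr1 mulr0 !addr0.
have dm' : cderiv (mob (- a)) (s^-1 * w' + a) (mob1 (- a) v) by rewrite wv.
exact: cderiv_derivable (cderiv_comp da dm').
Qed.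

End FrameE.
End ExtremalDiffeo.


(** * Anticonformal maps and reflections *)

Section Reflection.
Context {R : realType}.
Local Notation C := R[i].

Lemma derivable_cderiv (f : C -> C) z : derivable (f : C^o -> C^o) (z : C^o) 1 ->
  cderiv f z ('D_1 (f : C^o -> C^o) (z : C^o)).
Proof. by move=> fd; split. Qed.

Lemma near0_conj (P : C -> Prop) : (\forall h \near (0 : C^o), P h) ->
  \forall h \near (0 : C^o), P (h^*)%C.
Proof.
move=> /nbhs_ballP[e /= e0 eP]; apply/nbhs_ballP; exists e => //= h.
rewrite -ball_normE /= sub0r normrN => hlt; apply: eP.
by rewrite -ball_normE /= sub0r normrN normcJ.
Qed.

(** Schwarz reflection. *)
Lemma cderiv_reflect (f : C -> C) z d : cderiv f z d ->
  cderiv (fun w => ((f (w^*)%C)^*)%C) (z^*)%C (d^*)%C.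
Proof.
move=> fd; apply: near_cderivI => e e0.
have := near0_conj (cderiv_small_o fd e0); apply: filterS => h /=.
rewrite normcJ -(normcJ (f _ - _ - _)); congr (`|_| <= _).
by rewrite !rmorphB rmorphM /= rmorphD /= !conjcK.
Qed.

Lemma conj_bij (A : Type) (B : set A) (V : set C) f : set_bij B V f ->
  set_bij B (@conjc R @` V) (fun z => (f z)^*)%C.
Proof.
move=> [fV fI fS]; split.
- by move=> z Bz; exists (f z) => //; exact: fV.
- by move=> x y Bx By /(can_inj (@conjcK R)); exact: fI.
- by move=> _ [x Vx <-]; have [z Bz <-] := fS x Vx; exists z.
Qed.

Lemma conj_image2 (V : set C) : @conjc R @` (@conjc R @` V) = V.
Proof.
apply/seteqP; split=> x; first by move=> [_ [y Vy <-] <-]; rewrite conjcK.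
by move=> Vx; exists (x^*)%C; [exists x|rewrite conjcK].
Qed.

Lemma antibiholomorphicE (B V : set C) f : antibiholomorphic B V f <->
  biholomorphic B (@conjc R @` V) (fun z => (f z)^*)%C.
Proof.
split=> -[fb fh [g [gK gh]]].
- split; [exact: conj_bij|exact: fh|exists (fun w => g (w^*)%C); split].
    by move=> z Bz; rewrite conjcK gK.
  move=> _ [v Vv <-].
  have -> : (fun w => g (w^*)%C) = (fun w => (((g (w^*)%C)^*)^*)%C).
    by apply/funext => w; rewrite conjcK.
  exact: cderiv_derivable (cderiv_reflect (derivable_cderiv (gh v Vv))).
- split.
  + have := conj_bij fb; rewrite conj_image2; 
    by have -> : (fun z => ((f z)^*)^*)%C = f by apply/funext => z; rewrite conjcK.
  + exact: fh.
  exists (fun w => g (w^*)%C); split; first by move=> z Bz; rewrite gK.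
  move=> v Vv; have Vv' : (@conjc R @` V) (v^*)%C by exists v.
  have := cderiv_derivable (cderiv_reflect (derivable_cderiv (gh _ Vv'))).
  by rewrite conjcK.
Qed.

(** Changing the sign of [e2] conjugates the coordinates. *)
Lemma anticonformalE (H : normedModType R) (dot : {dot H for idfun}) p L e1 e2
    (F : R * R -> H) : anticonformal_diffeo dot p L e1 e2 F <->
  conformal_diffeo dot p L e1 (- e2) F.
Proof.
have pcE x : plane_coord dot p e1 (- e2) x = ((plane_coord dot p e1 e2 x)^*)%C.
  by rewrite /plane_coord /= dotNr.
rewrite /anticonformal_diffeo /conformal_diffeo.
have -> : plane_coord dot p e1 (- e2) @` affine_disk p L =
    @conjc R @` (plane_coord dot p e1 e2 @` affine_disk p L).
  apply/seteqP; split=> x.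
    by move=> [y Ly <-]; exists (plane_coord dot p e1 e2 y) => //; exists y.
  by move=> [_ [y Ly <-] <-]; exists y.
have -> : in_coord dot p e1 (- e2) F = (fun z => (in_coord dot p e1 e2 F z)^*)%C.
  by apply/funext => z; rewrite /in_coord pcE.
by rewrite (propext (antibiholomorphicE _ _ _)).
Qed.

End Reflection.

(** * Composition and inversion of holomorphic maps *)

Section HolCalculus.
Context {R : realType}.
Local Notation C := R[i].

Definition ccont (f : C -> C) z := {for z, continuous (f : C^o -> C^o)}.

Lemma ccontM f g z : ccont f z -> ccont g z -> ccont (fun w => f w * g w) z.
Proof. by move=> cf cg; exact: (@continuousM C C^o f g z cf cg). Qed.

Lemma ccontD f g z : ccont f z -> ccont g z -> ccont (fun w => f w + g w) z.
Proof. by move=> cf cg; exact: (@continuousD C C^o C^o f g z cf cg). Qed.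

Lemma ccontN f z : ccont f z -> ccont (fun w => - f w) z.
Proof. by move=> cf; exact: (@continuousN C C^o C^o f z cf). Qed.

Lemma ccontV f z : f z != 0 -> ccont f z -> ccont (fun w => (f w)^-1) z.
Proof. by move=> f0 cf; exact: (@continuousV C C^o f z f0 cf). Qed.

Lemma ccontX f n z : ccont f z -> ccont (fun w => f w ^+ n) z.
Proof.
move=> cf; elim: n => [|n IH]; first exact: (@cst_continuous C^o C^o 1 z).
have -> : (fun w => f w ^+ n.+1) = (fun w => f w * f w ^+ n).
  by apply/funext => w; rewrite exprS.
exact: (ccontM cf IH).
Qed.

Lemma ccont_comp f g z : ccont f z -> ccont g (f z) -> ccont (fun w => g (f w)) z.
Proof. by move=> cf cg; exact: (continuous_comp cf cg). Qed.

Lemma hol2_comp (D E : set C) m m1 m2 g g1 g2 : hol2 D m m1 m2 ->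
  hol2 E g g1 g2 -> (forall z, D z -> E (m z)) ->
  hol2 D (fun z => g (m z)) (fun z => g1 (m z) * m1 z)
    (fun z => g2 (m z) * m1 z ^+ 2 + g1 (m z) * m2 z).
Proof.
move=> hm hg DE z Dz; have [dm dm1 cm2] := hm z Dz.
have [dg dg1 cg2] := hg _ (DE z Dz).
split; first exact: cderiv_comp.
  apply: cderiv_eq (cderivM (cderiv_comp dm dg1) dm1) _.
  by rewrite expr2; ring.
have cm : ccont m z := cderiv_continuous dm.
have cm1 : ccont m1 z := cderiv_continuous dm1.
have cg2m : ccont (fun w => g2 (m w)) z := ccont_comp cm cg2.
have cg1m : ccont (fun w => g1 (m w)) z := ccont_comp cm (cderiv_continuous dg1).
exact: (ccontD (ccontM cg2m (ccontX (n := 2) cm1)) (ccontM cg1m cm2)).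
Qed.

Lemma hol2_affine (s t : C) : hol2 setT (fun w => s * w + t) (fun=> s) (fun=> 0).
Proof.
move=> z _; split; last exact: (@cst_continuous C^o C^o 0 z).
  have dM := cderivM (cderiv_cst s z) (cderiv_id z).
  apply: cderiv_eq (cderivD dM (cderiv_cst t z)) _.
  by rewrite mulr1 mulr0 !addr0.
exact: cderiv_cst.
Qed.

(** The chain rule for [g (f z) = z] shows that [f1] has no zero and that the
    derivative of [g] is [1 / f1 (g w)]; this expression can be differentiated
    again, which gives [g] a second derivative. *)
Lemma hol2_inverse (D V : set C) f f1 f2 g : hol2 D f f1 f2 ->
  (forall z, D z -> \forall w \near (z : C^o), D w) ->
  (forall z, D z -> g (f z) = z) -> V `<=` f @` D -> holomorphic_on V g ->
  hol2 V g (fun w => (f1 (g w))^-1) (fun w => - f2 (g w) / f1 (g w) ^+ 3) /\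
  forall w, V w -> D (g w) /\ f1 (g w) != 0.
Proof.
move=> hf Dn gK Vf gh.
have key w : V w -> [/\ D (g w), f1 (g w) != 0 & cderiv g w (f1 (g w))^-1].
  move=> Vw; have [z Dz fz] := Vf w Vw.
  have gw : g w = z by rewrite -fz gK.
  have [df _ _] := hf z Dz.
  move: (derivable_cderiv (gh w Vw)); set d := (X in cderiv _ _ X) => dg.
  have d1 : d * f1 z = 1.
    apply: (@cderiv_uniq _ id z); last exact: cderiv_id.
    apply: (@near_cderiv _ (fun w => g (f w))).
      by apply: filterS (Dn z Dz) => y; exact: gK.
    have dg' : cderiv g (f z) d by rewrite fz.
    exact: (cderiv_comp df dg').
  have f1n0 : f1 z != 0.
    by apply/eqP => f10; move/eqP: d1; rewrite f10 mulr0 eq_sym oner_eq0.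
  rewrite gw; split => //.
  by apply: cderiv_eq dg _; apply: (mulIf f1n0); rewrite d1 mulVf.
split; last by move=> w /key[].
move=> w Vw; have [Dg f1n0 dg] := key w Vw; have [_ df1 cf2] := hf _ Dg.
split; first exact: dg.
  have df1g := cderiv_comp dg df1.
  apply: cderiv_eq (cderivV (f := fun w => f1 (g w)) f1n0 df1g) _.
  by field.
have cg : ccont g w := cderiv_continuous dg.
have cf2g : ccont (fun w => f2 (g w)) w := ccont_comp cg cf2.
have cf1g : ccont (fun w => f1 (g w)) w := ccont_comp cg (cderiv_continuous df1).
have f13 : f1 (g w) ^+ 3 != 0 by rewrite expf_neq0.
have cV := ccontV (f := fun w => f1 (g w) ^+ 3) f13 (ccontX (n := 3) cf1g).
exact: (ccontM (ccontN cf2g) cV).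
Qed.

End HolCalculus.


(** * Conformal diffeomorphisms attain the bound *)

Section Converse.
Context {R : realType} {H : normedModType R} (dot : {dot H for idfun}).
Hypothesis norm_dot : forall x : H, `|x| ^+ 2 = dot x x.
Local Notation C := R[i].
Local Notation Re := complex.Re.
Local Notation Im := complex.Im.
Local Notation U := (@unit_disk R).
Local Notation D := (@pair_of_complex R @^-1` @unit_disk R).

Lemma grad_uniq (f : R * R -> R) z (a b a' b' : R) :
  is_diff z f (lin2 a b) -> is_diff z f (lin2 a' b') -> a = a' /\ b = b'.
Proof.
move=> [_ E] [_]; rewrite E => E'.
have h1 := congr1 (fun g => g (1, 0)) E'; have h2 := congr1 (fun g => g (0, 1)) E'.
move: h1 h2; rewrite /lin2 /= !scale1r !scale0r !addr0 !add0r.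
by [].
Qed.

(** The first partial derivatives satisfy the Cauchy-Riemann equations on the
    disk, hence so do their gradients up to exchanging the two variables.
    Harmonicity rewrites the derivative in the second variable twice as one in
    the first variable, which gives the Cauchy-Riemann equations for the complex
    derivative. *)
Lemma in_coord_hol2 p e1 e2 (F Fx Fy Fxx Fxy Fyx Fyy : R * R -> H) :
  second_grad U F Fx Fy Fxx Fxy Fyx Fyy ->
  (forall z, U z -> Fxx z + Fyy z = 0) ->
  holomorphic_on D (in_coord dot p e1 e2 F) ->
  hol2 D (in_coord dot p e1 e2 F)
    (fun z => Complex (dot (Fx (pair_of_complex z)) e1)
                      (dot (Fx (pair_of_complex z)) e2))
    (fun z => Complex (dot (Fxx (pair_of_complex z)) e1)
                      (dot (Fxx (pair_of_complex z)) e2)).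
Proof.
move=> F2 lap hF.
have S e := second_grad_dot norm_dot e F2.
have gFp e : has_grad U (fun q => dot (F q - p) e) (fun q => dot (Fx q) e)
    (fun q => dot (Fy q) e).
  have gB : has_grad U (fun q => F q - p) Fx Fy.
    move=> q Uq; have := is_diffB (grad_f F2 Uq) (is_diff_cst p q).
    by congr is_diff_def; apply/funext => h; rewrite !fctE subr0.
  exact: has_grad_dot gB.
have CR q : U q -> [/\ cderiv (in_coord dot p e1 e2 F) (cplx q)
    (Complex (dot (Fx q) e1) (dot (Fx q) e2)),
    dot (Fx q) e1 = dot (Fy q) e2 & dot (Fx q) e2 = - dot (Fy q) e1].
  move=> Uq; have Dq : D (cplx q) by rewrite /= cplxK.
  move: (derivable_cderiv (hF _ Dq)); set d := (X in cderiv _ _ X) => dF.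
  have d1 := cderiv_Re_diff dF; have d2 := cderiv_Im_diff dF.
  have E1 : (fun q => Re (in_coord dot p e1 e2 F (cplx q))) =
      (fun q => dot (F q - p) e1).
    by apply/funext => r; rewrite /in_coord /= cplxK.
  have E2 : (fun q => Im (in_coord dot p e1 e2 F (cplx q))) =
      (fun q => dot (F q - p) e2).
    by apply/funext => r; rewrite /in_coord /= cplxK.
  rewrite E1 in d1; rewrite E2 in d2.
  have [r1 r2] := grad_uniq d1 (gFp e1 q Uq).
  have [i1 i2] := grad_uniq d2 (gFp e2 q Uq).
  rewrite -r1 -i1 -r2 -i2 opprK; split => //.
  by apply: cderiv_eq dF _; case: (d).
have nearU q : U q -> \forall w \near q, U w.
  by move=> Uq; exact: open_nbhs_nbhs (conj (@open_unit_disk R) Uq).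
move=> z Dz; rewrite -(pair_of_complexK z); set q := pair_of_complex z.
have Uq : U q by [].
have [d1 _ _] := CR q Uq; rewrite !cplxK; split => //.
- set F1 := fun z => Complex _ _.
  have R1 : (fun q => Re (F1 (cplx q))) = (fun q => dot (Fx q) e1).
    by apply/funext => r; rewrite /F1 cplxK.
  have I1 : (fun q => Im (F1 (cplx q))) = (fun q => dot (Fx q) e2).
    by apply/funext => r; rewrite /F1 cplxK.
  have near_grad (f g : R * R -> R) (x y x' y' : R) :
      (forall w, U w -> f w = g w) -> is_diff q f (lin2 x y) ->
      is_diff q g (lin2 x' y') -> x = x' /\ y = y'.
    move=> fg df dg; apply: grad_uniq dg; apply: near_eq_is_diff df.
    by apply: filterS (nearU q Uq) => w Uw; exact: fg.
  have L e : dot (Fyy q) e = - dot (Fxx q) e.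
    by apply/eqP; rewrite -addr_eq0 -dotDl addrC lap// dot0l.
  have [_ H1] := near_grad _ _ _ _ _ _
    (fun w Uw => let: And3 _ h _ := CR w Uw in h)
    (grad_fx (S e1) Uq) (grad_fy (S e2) Uq).
  have gN : is_diff q (fun w => - dot (Fy w) e1)
      (lin2 (- dot (Fyx q) e1) (- dot (Fyy q) e1)).
    have := is_diffN (grad_fy (S e1) Uq); congr is_diff_def.
    by apply/funext => h; rewrite !fctE /lin2 !scalerN opprD.
  have [_ H2] := near_grad _ _ _ _ _ _
    (fun w Uw => let: And3 _ _ h := CR w Uw in h)
    (grad_fx (S e2) Uq) gN.
  apply: grad_cderiv.
    rewrite R1; have := grad_fx (S e1) Uq.
    by rewrite H1 L.
  rewrite I1; have := grad_fx (S e2) Uq.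
  by rewrite H2 L opprK.
- have c12 : {for q, continuous (fun w => (dot (Fxx w) e1, dot (Fxx w) e2))}.
    by apply: continuous_pair_for; [exact: (cont_fxx (S e1))|exact: (cont_fxx (S e2))].
  have cpair := @pair_of_complex_continuous R z.
  have := continuous_comp (continuous_comp cpair c12) (@cplx_continuous R _).
  by rewrite /= pair_of_complexK.
Qed.

(** The Schwarz lemma for the self-map of the disk obtained by composing the
    inverse of [F] with the extremal parametrization; it is the case [c = 0],
    [rho = 1], [a = 0] of [competitor_le]. *)
Lemma conformal_diffeo_factor_ge p e1 e2 (c : H) (rho : R) (a : C)
    (F Fx Fy Fxx Fxy Fyx Fyy : R * R -> H) (lam : R) :
  dot e1 e1 = 1 -> dot e2 e2 = 1 -> dot e1 e2 = 0 ->
  dot c e1 = 0 -> dot c e2 = 0 -> 0 < rho -> rho ^+ 2 = 1 - dot c c ->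
  `|a| < 1 -> p = c + place (rho *: e1) (rho *: e2) a ->
  second_grad U F Fx Fy Fxx Fxy Fyx Fyy ->
  (forall z, U z -> Fxx z + Fyy z = 0) ->
  F 0 = p -> 0 < lam -> dot (Fx 0) (Fx 0) = lam ^+ 2 -> span2 e1 e2 (Fx 0) ->
  conformal_diffeo dot p (span2 e1 e2) e1 e2 F ->
  rho * (1 - (Re a ^+ 2 + Im a ^+ 2)) <= lam.
Proof.
move=> e11 e22 e12 ce1 ce2 rho0 rhoE a1 pE F2 lap F0 lam0 Fx0 Fx0L.
move=> [Fbij [bij hF [g [gK hg]]]].
have e21 : dot e2 e1 = 0 by rewrite dotC.
have u1E : 1 *: e1 + 0 *: e2 = e1 by rewrite scale1r scale0r addr0.
have u2E : - 0 *: e1 + 1 *: e2 = e2 by rewrite scale1r oppr0 scale0r add0r.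
have k12 : 1 ^+ 2 + 0 ^+ 2 = 1 :> R by rewrite expr1n expr0n addr0.
set n2 := Re a ^+ 2 + Im a ^+ 2.
set V := plane_coord dot p e1 e2 @` affine_disk p (span2 e1 e2) in bij hg.
have FH := in_coord_hol2 F2 lap hF.
set f1 := (f1 in hol2 _ _ f1 _) in FH; set f2 := (f2 in hol2 _ _ _ f2) in FH.
have VF : V `<=` in_coord dot p e1 e2 F @` D by case: bij.
have gK' z : D z -> g (in_coord dot p e1 e2 F z) = z.
  by move=> Dz; apply: gK; exact/mem_set.
have [gH gD] := hol2_inverse FH (@near_disk R) gK' VF hg.
set Dc := [set z : C | `|z| < 1].
pose phi z := rho%:C%C * (mob a z - a).
have phiH : hol2 Dc phi (fun z => rho%:C%C * mob1 a z)
    (fun z => rho%:C%C * mob2 a z).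
  have := hol2_comp (mob_hol2 a1) (hol2_affine rho%:C%C (- (rho%:C%C * a)))
    (fun _ _ => Logic.I).
  congr hol2; apply/funext => z; first by rewrite /phi mulrBr.
  by rewrite mul0r add0r.
have phiV z : Dc z -> V (phi z).
  move=> z1; have m1 := mob_lt1 a1 z1.
  exists (c + place (rho *: e1) (rho *: e2) (mob a z)).
    rewrite pE; have := @affine_disk_place _ _ _ norm_dot e1 e2 e11 e22 e12 1 0
      c rho a k12; rewrite u1E u2E; exact.
  rewrite pE; have := @plane_coord_place _ _ dot e1 e2 e11 e22 e12 1 0
      c rho a; rewrite u1E u2E => ->.
  by rewrite /phi; congr (_ * _); apply/eqP; rewrite eq_complex /=; apply/andP;
    split; apply/eqP; ring.
have kH := hol2_comp phiH gH phiV.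
have D0 : D (0 : C) by exact: unit_disk0.
have Dc0 : Dc (0 : C) by rewrite /Dc /= normr0.
have phi0 : phi 0 = in_coord dot p e1 e2 F 0.
  rewrite /phi /mob add0r mulr0 addr0 divr1 subrr mulr0 /in_coord.
  have -> : pair_of_complex (0 : C) = 0 by [].
  by rewrite F0 /plane_coord subrr !dot0l.
have k0 : g (phi 0) = 0 by rewrite phi0 gK'.
pose k1 := (f1 (g (phi 0)))^-1 * (rho%:C%C * mob1 a 0).
have k1E : k1 = (f1 0)^-1 * (rho * (1 - n2))%:C%C.
  by rewrite /k1 k0 mob1_0 rmorphM.
have f10n0 : f1 0 != 0 by have [_] := gD _ (phiV 0 Dc0); rewrite k0.
have b0 : 0 < rho * (1 - n2) by rewrite mulr_gt0// subr_gt0 abs_lt1.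
have f10N : `|f1 0| = lam%:C%C.
  apply/eqP; rewrite -(@eqrXn2 _ 2)//; last by rewrite ler0c ltW.
  rewrite normc_sqrE -rmorphXn -Fx0 /f1.
  have -> : pair_of_complex (0 : C) = 0 by [].
  rewrite /=.
  case: Fx0L => s [t ->].
  by rewrite !dotE e11 e22 e12 e21; apply/eqP; congr (_%:C%C); ring.
(* a rotation s makes the derivative at the origin equal to mu > 0, so that the
   self-map becomes a competitor in the frame e1, e2 *)
pose mu := rho * (1 - n2) / lam.
pose s := f1 0 / lam%:C%C.
have l0 : lam%:C%C != 0 :> C by rewrite eq_complex /= negb_and gt_eqF.
have sN : `|s| = 1 by rewrite /s normf_div f10N ger0_norm ?divff// ler0c ltW.
have rH := hol2_comp kH (hol2_affine s 0) (fun _ _ => Logic.I).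
have S := hol2_second_grad (0 : H) e1 e2 rH.
have UE : cplx @^-1` Dc = U.
  by apply/seteqP; split => z /unit_disk_cplx.
rewrite UE in S.
set G := (G in second_grad _ G) in S.
have sk1 : s * k1 = mu%:C%C.
  rewrite k1E /s /mu [in RHS]rmorphM fmorphV /=.
  by rewrite mulrACA; field; rewrite f10n0 l0.
have cplx0 : cplx (0 : R * R) = 0 by [].
have a01 : `|0 : C| < 1 by rewrite normr0.
have compG : competitor 0 e1 e2 1 0 G mu.
  do 6 eexists; split; first exact: S.
  - by move=> z _; rewrite subrr.
  - move=> z Uz; have z1 : `|cplx z| < 1 by exact/unit_disk_cplx.
    rewrite -(@expr_lt1 _ 2)// norm_dot /G add0r addr0 /place.
    rewrite !dotE e11 e22 e12 e21 !mulr0 !mulr1 addr0 add0r -!expr2.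
    rewrite abs_lt1// normrM sN mul1r.
    have [Dg _] := gD _ (phiV _ z1); exact/unit_disk_pair.
  - rewrite /G /extremal cplx0 k0 /mob !mulr0 !addr0 mul0r.
    by rewrite /place /= !scale0r.
  - cbv beta; rewrite cplx0 -/k1 sk1 /place mulic /= oppr0 !scale0r addr0 add0r //.
have H0 : dot (0 : H) e1 = 0 by rewrite dot0l.
have H0' : dot (0 : H) e2 = 0 by rewrite dot0l.
have rE : 1 ^+ 2 = 1 - dot (0 : H) 0 by rewrite dot0l subr0 expr1n.
have := competitor_le norm_dot e11 e22 e12 H0 H0' ltr01 rE a01 compG.
by rewrite expr0n addr0 subr0 mulr1 /mu ler_pdivrMr// mul1r.
Qed.

End Converse.


(** * The theorem *)

Section Bases.
Context {R : realType} {H : normedModType R} (dot : {dot H for idfun}).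

(** The determinant of the change of basis has square one; its sign decides
    between the two cases. *)
Lemma orthonormal_change (e1 e2 u1 u2 : H) :
  dot e1 e1 = 1 -> dot e2 e2 = 1 -> dot e1 e2 = 0 ->
  dot u1 u1 = 1 -> dot u2 u2 = 1 -> dot u1 u2 = 0 ->
  span2 u1 u2 = span2 e1 e2 ->
  exists k1 k2, [/\ k1 ^+ 2 + k2 ^+ 2 = 1, u1 = k1 *: e1 + k2 *: e2 &
    u2 = - k2 *: e1 + k1 *: e2 \/ u2 = k2 *: e1 + - k1 *: e2].
Proof.
move=> e11 e22 e12 u11 u22 u12 uE; have e21 : dot e2 e1 = 0 by rewrite dotC.
have [k1 [k2 u1E]] : span2 e1 e2 u1.
  by rewrite -uE; exists 1, 0; rewrite scale1r scale0r addr0.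
have [s [t u2E]] : span2 e1 e2 u2.
  by rewrite -uE; exists 0, 1; rewrite scale1r scale0r add0r.
have kk : k1 ^+ 2 + k2 ^+ 2 = 1.
  by rewrite -[RHS]u11 u1E !dotE e11 e22 e12 e21; ring.
have st : s ^+ 2 + t ^+ 2 = 1.
  by rewrite -[RHS]u22 u2E !dotE e11 e22 e12 e21; ring.
have ks : k1 * s + k2 * t = 0.
  by rewrite -[RHS]u12 u1E u2E !dotE e11 e22 e12 e21; ring.
pose d := k1 * t - k2 * s.
have sE : s = - k2 * d.
  rewrite -[LHS]mul1r -kk /d -[RHS]addr0 -[X in _ = _ + X](mulr0 k1) -ks; ring.
have tE : t = k1 * d.
  rewrite -[LHS]mul1r -kk /d -[RHS]addr0 -[X in _ = _ + X](mulr0 k2) -ks; ring.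
have : d ^+ 2 == 1.
  have -> : d ^+ 2 = (k1 ^+ 2 + k2 ^+ 2) * (s ^+ 2 + t ^+ 2) -
    (k1 * s + k2 * t) ^+ 2 by rewrite /d; ring.
  by rewrite kk st ks expr0n subr0 mul1r.
rewrite sqrf_eq1 => /orP[] /eqP dE; exists k1, k2; split => //; [left|right].
  by rewrite u2E sE tE dE !mulr1.
by rewrite u2E sE tE dE !mulrN1 opprK.
Qed.

Lemma span2N (e1 e2 : H) : span2 e1 (- e2) = span2 e1 e2.
Proof.
apply/seteqP; split=> x [s [t ->]]; exists s, (- t).
  by rewrite scaleNr scalerN.
by rewrite scaleNr scalerN opprK.
Qed.

End Bases.
Unset Implicit Arguments.

Theorem theorem6p2 (R : realType) (H : completeNormedModType R)
    (dot : {dot H for idfun})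
    (norm_dot : forall x : H, `|x| ^+ 2 = dot x x)
    (dim_ge2 : exists a b : H, lin_indep2 a b) :
  (* the estimate and its equality case *)
  (forall (F : R * R -> H) (p : H) (lam : R),
     harmonic_on (@unit_disk R) F ->
     (forall z, unit_disk z -> `|F z| < 1) ->
     F 0 = p ->
     conformal_with_factor ('d F (0 : R * R)) lam ->
     let L := range ('d F (0 : R * R)) in
     lam <= conformal_bound dot p L /\
     (forall e1 e2 : H, orthonormal_basis2 dot L e1 e2 ->
        (lam = conformal_bound dot p L <->
         conformal_diffeo dot p L e1 e2 F \/
         anticonformal_diffeo dot p L e1 e2 F))) /\
  (* sharpness *)
  (forall (p : H) (L : set H), `|p| < 1 -> is_plane L ->
     exists F : R * R -> H,
       [/\ harmonic_on (@unit_disk R) F,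
           forall z, unit_disk z -> `|F z| < 1,
           F 0 = p,
           conformal_with_factor ('d F (0 : R * R)) (conformal_bound dot p L)
         & range ('d F (0 : R * R)) = L]).
Proof.
split; last by move=> p L; exact: extremal_sharp.
move=> F p lam hF F1 F0 Fc L; rewrite {}/L.
have [Fx [Fy [Fxx [Fxy [Fyx [Fyy [F2 lap]]]]]]] := harmonic_second_grad hF.
have dE h : 'd F (0 : R * R) h = h.1 *: Fx 0 + h.2 *: Fy 0.
  by have [_ ->] := grad_f F2 (@unit_disk0 R).
have [u1 [u2 [u11 u22 u12 [FxE FyE] LE]]] := conformal_frame norm_dot dE Fc.
have lam0 : 0 < lam by case: Fc.
have p1 : `|p| < 1 by rewrite -F0; apply: F1; exact: unit_disk0.
have [c [rho [a [[cu1 cu2] rho0 rhoE [a1 pE] bE]]]] :=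
  frame_exists norm_dot u11 u22 u12 p1.
have FF : competitor c u1 u2 rho a F lam.
  by exists Fx, Fy, Fxx, Fxy, Fyx, Fyy; split=> //; rewrite F0 extremal0.
have le_lam : lam <= conformal_bound dot p (span2 u1 u2).
  by rewrite bE; exact: competitor_le FF.
rewrite LE; split=> // e1 e2 [e11 e22 e12 spanE].
(* stated for a basis e1, e, so as to serve for e = e2 and for e = - e2 *)
have conf e : dot e e = 1 -> dot e1 e = 0 -> span2 u1 u2 = span2 e1 e ->
    conformal_diffeo dot p (span2 u1 u2) e1 e F ->
    lam = conformal_bound dot p (span2 u1 u2).
  move=> ee e1e sE Fconf; apply/eqP; rewrite eq_le le_lam /=.
  rewrite sE in Fconf *.
  have [c' [r' [a' [[ce1 ce2] r0' rE' [a1' pE'] ->]]]] :=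
    frame_exists norm_dot e11 ee e1e p1.
  apply: (conformal_diffeo_factor_ge norm_dot e11 ee e1e ce1 ce2 r0' rE' a1' pE'
    F2 lap F0 lam0 _ _ Fconf).
    by rewrite FxE dotZl dotZr u11; ring.
  by rewrite -sE FxE; exists lam, 0; rewrite scale0r addr0.
split=> [lamE|[]]; last first.
- move/anticonformalE; apply: conf.
  + by rewrite dotNl dotNr opprK.
  + by rewrite dotNr e12 oppr0.
  + by rewrite span2N.
- exact: conf.
rewrite lamE bE in FF.
have FE := competitor_unique norm_dot u11 u22 u12 cu1 cu2 rho0 rhoE a1 FF.
have [k1 [k2 [kk u1E u2E]]] := orthonormal_change e11 e22 e12 u11 u22 u12 spanE.
(* a rotation between the bases makes F conformal, a reflection anticonformal *)
case: u2E => u2E; [left|right; apply/anticonformalE].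
  rewrite spanE pE; move: cu1 cu2 FE; rewrite u1E u2E => cu1 cu2 FE.
  exact: (extremal_conformal norm_dot e11 e22 e12 kk cu1 cu2 rho0 rhoE a1 FE).
have e22' : dot (- e2) (- e2) = 1 by rewrite dotNl dotNr opprK.
have e12' : dot e1 (- e2) = 0 by rewrite dotNr e12 oppr0.
have kk' : k1 ^+ 2 + (- k2) ^+ 2 = 1 by rewrite sqrrN.
rewrite spanE pE -span2N.
have u1E' : u1 = k1 *: e1 + - k2 *: - e2 by rewrite scalerN scaleNr opprK.
have u2E' : u2 = - - k2 *: e1 + k1 *: - e2.
  by rewrite opprK scalerN -scaleNr.
move: cu1 cu2 FE; rewrite u1E' u2E' => cu1 cu2 FE.
exact: (extremal_conformal norm_dot e11 e22' e12' kk' cu1 cu2 rho0 rhoE a1 FE).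
Qed.
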